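(* Let $a\ge2$, $n\ge3$ and $1\le c\le a$ be integers, and put $A_0=0$ and $A_i=\dfrac{a^i-1}{a-1}$ for $1\le i\le n$. Let $m=cA_{n-1}+1$ and let $b\in\mathbb Z$ satisfy $b\ge-(a-2)m-2$ and $\gcd(m,b)=1$. Put $d=(a-1)m+b$, $s_i=m+dA_i$ for $0\le i\le n-1$, and $H=\langle s_0,\ldots,s_{n-1}\rangle$. Then the following hold. 1) $\mathrm{PF}(H)=\{h+\alpha,h+2\alpha,\ldots,h+(n-1)\alpha\}$ for some integers $h\ge0$, $\alpha>0$. 2) $h$ has a unique factorization in $H=\langle s_0,\ldots,s_{n-1}\rangle$, and for any field $k$ $$I_H=\mathrm I_2\begin{pmatrix}X_1^a&X_2^a&\cdots&X_{n-1}^a&X_n^c\\ X_2&X_3&\cdots&X_n&X_1^{d+c+1-a}\end{pmatrix}.$$ Consequently, the Eagon--Northcott complex associated to this matrix gives the graded minimal free resolution of $k[H]$ over $S$.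
   Context: $\mathbb N=\{0,1,2,\ldots\}$. A numerical semigroup is a submonoid $H$ of $\mathbb N$ (containing $0$) with finite complement in $\mathbb N$; $\langle s_0,\ldots,s_{n-1}\rangle$ is the set of all $\mathbb N$-linear combinations of the $s_i$. The set of pseudo-Frobenius numbers is $\mathrm{PF}(H)=\{f\in\mathbb Z\setminus H : f+s\in H \text{ for every } 0<s\in H\}$. A factorization of $h$ in $H$ is a tuple $(x_0,\ldots,x_{n-1})\in\mathbb N^n$ with $h=\sum_i x_is_i$; $h$ has a unique factorization if there is exactly one such tuple. Let $k$ be a field, $k[H]=k[t^{s_0},\ldots,t^{s_{n-1}}]\subseteq k[t]$, and $S=k[X_1,\ldots,X_n]$ graded by $\deg X_i=s_{i-1}$ for $1\le i\le n$. The defining ideal $I_H$ is the kernel of the graded $k$-algebra map $S\to k[H]$, $X_i\mapsto t^{s_{i-1}}$. For a matrix $M$ with entries in $S$, $\mathrm I_2(M)$ is the ideal generated by the $2\times2$ minors of $M$. The Eagon--Northcott complex of a $2\times n$ matrix over $S$, viewed as a map $\phi:F=S^n\to G=S^2$, is the complex $0\to \bigwedge^{n}F\otimes(\mathrm{Sym}_{n-2}G)^*\to\cdots\to\bigwedge^{3}F\otimes(\mathrm{Sym}_1G)^*\to\bigwedge^2F\to S$. The last map is $\bigwedge^2\phi$ (with $\bigwedge^2 G\cong S$). The other maps are $e_{i_1}\wedge\cdots\wedge e_{i_p}\otimes u\mapsto\sum_{s}(-1)^{s-1}e_{i_1}\wedge\cdots\widehat{e_{i_s}}\cdots\wedge e_{i_p}\otimes(\phi(e_{i_s})\cdot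 u)$, where $g\cdot u$ is the contraction $(g\cdot u)(x)=u(gx)$. The complex is graded so that all maps are homogeneous of degree $0$. *)

(* Defs.v *)
From HB Require Import structures.
From mathcomp Require Import all_boot all_order all_algebra.
From mathcomp Require Import mpoly zify.

Set Implicit Arguments.
Unset Strict Implicit.
Unset Printing Implicit Defensive.

Import Order.TTheory GRing.Theory Num.Theory.
Local Open Scope ring_scope.

(** * Numerical semigroups *)

Definition numerical_semigroup (H : nat -> Prop) : Prop :=
  [/\ H 0%N,
      forall x y, H x -> H y -> H (x + y)%N
    & exists gaps : seq nat, forall x, ~ H x -> x \in gaps].

Definition factorization (n : nat) (s : 'I_n -> nat) (h : nat)
    (x : {ffun 'I_n -> nat}) : Prop :=
  h = (\sum_(i < n) x i * s i)%N.

Definition gen_semigroup (n : nat) (s : 'I_n -> nat) (h : nat) : Prop :=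
  exists x, factorization s h x.

Definition unique_factorization (n : nat) (s : 'I_n -> nat) (h : nat) : Prop :=
  exists! x, factorization s h x.

Definition memZ (H : nat -> Prop) (z : int) : Prop :=
  exists2 h : nat, H h & z = h%:Z.

Definition PF (H : nat -> Prop) (f : int) : Prop :=
  ~ memZ H f /\ forall h : nat, (0 < h)%N -> H h -> memZ H (f + h%:Z).

(** * Ideals *)

Definition ideal_gen (R : comNzRingType) (P : R -> Prop) (f : R) : Prop :=
  exists2 l : seq (R * R),
    (forall cg, cg \in l -> P cg.2) & f = \sum_(cg <- l) cg.1 * cg.2.

Definition minor2 (R : comNzRingType) (p q : nat) (M : 'M[R]_(p, q))
    (i1 i2 : 'I_p) (j1 j2 : 'I_q) : R :=
  M i1 j1 * M i2 j2 - M i1 j2 * M i2 j1.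

Definition I2 (R : comNzRingType) (p q : nat) (M : 'M[R]_(p, q)) : R -> Prop :=
  ideal_gen (fun g => exists (i1 i2 : 'I_p) (j1 j2 : 'I_q),
    [/\ (i1 < i2)%N, (j1 < j2)%N & g = minor2 M i1 i2 j1 j2]).

(** * The semigroup ring and its defining ideal *)

Definition toric (k : fieldType) (n : nat) (s : 'I_n -> nat)
    (f : {mpoly k[n]}) : {poly k} :=
  mmap polyC (fun i => 'X^(s i)) f.

Definition semigroup_ring (k : fieldType) (n : nat) (s : 'I_n -> nat)
    (p : {poly k}) : Prop :=
  exists f : {mpoly k[n]}, p = toric s f.

Definition defining_ideal (k : fieldType) (n : nat) (s : 'I_n -> nat)
    (f : {mpoly k[n]}) : Prop :=
  toric s f = 0.

(** * Complexes of finitely generated free modules *)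

(* The free module on a finite type [B] is [{ffun B -> R}]; a linear map is
   given by the coordinates [M x y] of the image of the basis vector [x]. *)
Definition free_map (R : comNzRingType) (B C : finType) (M : B -> C -> R)
    (v : {ffun B -> R}) : {ffun C -> R} :=
  [ffun y => \sum_x v x * M x y].

Record free_seq (R : comNzRingType) := FreeSeq {
  free_basis : nat -> finType;
  free_diff_coef : forall i, free_basis i.+1 -> free_basis i -> R
}.

Definition free_diff (R : comNzRingType) (C : free_seq R) (i : nat) :
    {ffun free_basis C i.+1 -> R} -> {ffun free_basis C i -> R} :=
  free_map (@free_diff_coef R C i).

(** * Graded minimal free resolutions of [k[H]] *)

Definition wdeg (n : nat) (w : 'I_n -> nat) (m : 'X_{1..n}) : nat :=
  (\sum_(i < n) m i * w i)%N.

(* [f] is homogeneous of degree [e] for [deg X_i = w i] (0 always is). *)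
Definition whomog (k : fieldType) (n : nat) (w : 'I_n -> nat) (e : int)
    (f : {mpoly k[n]}) : Prop :=
  forall m, m \in msupp f -> (wdeg w m)%:Z = e.

Definition irrelevant_ideal (k : fieldType) (n : nat) : {mpoly k[n]} -> Prop :=
  ideal_gen (fun g => exists i : 'I_n, g = 'X_i).

(* [k[t]] is an S-module through [toric s]; [eps] lists the images in it of the
   basis vectors of the free module in homological degree 0. *)
Definition augmentation (k : fieldType) (n : nat) (s : 'I_n -> nat)
    (B : finType) (eps : B -> {poly k}) (v : {ffun B -> {mpoly k[n]}}) :
    {poly k} :=
  \sum_x toric s (v x) * eps x.

(* [deg i x] is the degree of the basis vector [x], i.e. the module in
   homological degree [i] is the direct sum of the [S(- deg i x)]. *)
Record graded_minimal_free_resolution (k : fieldType) (n : nat)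
    (s : 'I_n -> nat) (C : free_seq {mpoly k[n]})
    (deg : forall i, free_basis C i -> int) (eps : free_basis C 0 -> {poly k}) :
    Prop := {
  gmfr_diff_homog : forall i (x : free_basis C i.+1) (y : free_basis C i),
    whomog s (deg i.+1 x - deg i y) (free_diff_coef x y);
  gmfr_eps_homog : forall (x : free_basis C 0) (j : nat),
    (eps x)`_j != 0 -> j%:Z = deg 0%N x;
  gmfr_eps_image : forall p : {poly k},
    semigroup_ring s p <-> exists v, p = augmentation s eps v;
  gmfr_exact0 : forall v,
    augmentation s eps v = 0 <-> exists u, v = free_diff (C := C) (i := 0) u;
  gmfr_exact : forall i (v : {ffun free_basis C i.+1 -> {mpoly k[n]}}),
    free_diff v = 0 <-> exists u, v = free_diff (C := C) (i := i.+1) u;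
  gmfr_minimal : forall i (u : {ffun free_basis C i.+1 -> {mpoly k[n]}}) y,
    irrelevant_ideal (free_diff u y)
}.

(** * The Eagon-Northcott complex of a 2 x n matrix *)

(* Basis in homological degree [i.+1]: the [e_I (x) u_j] with [#|I| = i.+2],
   where [u_j] is dual to [Y_0^(i-j) Y_1^j] in [Sym_i G]. For [i.+2 > n] there
   is no such [I], so the complex stops in homological degree [n.-1]. *)
Definition EN_basis (n i : nat) : finType :=
  if i is i'.+1 then ({I : {set 'I_n} | #|I| == i'.+2} * 'I_i'.+1)%type
  else unit.

(* A functional [u] on [Sym_(q+1) G] is the row of its values on the monomials
   [Y_0^(q+1-j) Y_1^j]; the contraction is [(g . u)(x) = u (g x)]. *)
Definition contraction (R : comNzRingType) (q : nat) (g : 'cV[R]_2)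
    (u : 'rV[R]_q.+2) : 'rV[R]_q.+1 :=
  \row_l (g 0 0 * u 0 (widen_ord (leqnSn _) l) + g 1 0 * u 0 (lift ord0 l)).

(* The double sum has a single term when [#|I| = 2]. *)
Definition wedge2_map (R : comNzRingType) (n : nat) (M : 'M[R]_(2, n))
    (I : {set 'I_n}) : R :=
  \sum_(i in I) \sum_(j in I | (i < j)%N) minor2 M 0 1 i j.

Definition EN_diff_coef (R : comNzRingType) (n : nat) (M : 'M[R]_(2, n))
    (i : nat) : EN_basis n i.+1 -> EN_basis n i -> R :=
  match i with
  | 0 => fun x _ => wedge2_map M (val x.1)
  | i'.+1 => fun x y =>
      \sum_(s in val x.1 | val x.1 :\ s == val y.1)
        (-1) ^+ #|[set t in val x.1 | (t < s)%N]|
        * contraction (col s M) (delta_mx 0 x.2) 0 y.2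
  end.

Definition Eagon_Northcott (R : comNzRingType) (n : nat) (M : 'M[R]_(2, n)) :
    free_seq R :=
  FreeSeq (@EN_diff_coef R n M).

(** * The family of semigroups *)

Definition repunit (a i : nat) : nat := ((a ^ i - 1) %/ (a - 1))%N.

Definition multiplicity (a n c : nat) : nat := (c * repunit a n.-1 + 1)%N.

Definition step (a n c : nat) (b : int) : int :=
  (a%:Z - 1) * (multiplicity a n c)%:Z + b.

(* The arguments of [absz] here and in [corner_exp] are nonnegative in the range
   of parameters considered: see [gens_pos] and [corner_expE]. *)
Definition gens (a n c : nat) (b : int) (i : 'I_n) : nat :=
  absz ((multiplicity a n c)%:Z + step a n c b * (repunit a i)%:Z)%R.

Definition corner_exp (a n c : nat) (b : int) : nat :=
  absz (step a n c b + c%:Z + 1 - a%:Z)%R.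

(* [ordS] is the cyclic successor, so the last column has [X_1] (index 0) in its
   second row. *)
Definition mat (k : fieldType) (a n c : nat) (b : int) :
    'M[{mpoly k[n]}]_(2, n) :=
  \matrix_(r < 2, j < n)
    let last_col := j.+1 == n in
    if r == 0 then 'X_j ^+ (if last_col then c else a)
    else 'X_(ordS j) ^+ (if last_col then corner_exp a n c b else 1).

Lemma repunitS (a i : nat) : (2 <= a)%N ->
  repunit a i.+1 = (a * repunit a i + 1)%N.
Proof.
move=> ha; have E j : repunit a j = (\sum_(l < j) a ^ l)%N.
  by rewrite /repunit !subn1 predn_exp mulKn //; lia.
rewrite !E big_ord_recl expn0 addnC big_distrr /=; congr (_ + _)%N.
by apply: eq_bigr => l _; rewrite /bump /= expnS.
Qed.

Lemma repunit_ge (a i : nat) : (2 <= a)%N -> (2 <= i)%N ->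
  (a.+1 <= repunit a i)%N.
Proof.
move=> ha; case: i => [|[|i]] // _; rewrite repunitS //.
have: (1 <= repunit a i.+1)%N by rewrite repunitS //; lia.
nia.
Qed.

Lemma mult_ge (a n c : nat) : (2 <= a)%N -> (3 <= n)%N -> (1 <= c)%N ->
  (a.+2 <= multiplicity a n c)%N.
Proof.
move=> ha hn hc; rewrite /multiplicity.
have: (a.+1 <= repunit a n.-1)%N by apply: repunit_ge => //; lia.
nia.
Qed.

Lemma step_ge (a n c : nat) (b : int) :
  (2 <= a)%N -> (3 <= n)%N -> (1 <= c)%N ->
  - (a%:Z - 2) * (multiplicity a n c)%:Z - 2 <= b -> a%:Z <= step a n c b.
Proof. by move=> ha hn hc hb; have := mult_ge ha hn hc; rewrite /step; lia. Qed.

Lemma gens_pos (a n c : nat) (b : int) (i : 'I_n) :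
  (2 <= a)%N -> (3 <= n)%N -> (1 <= c)%N ->
  - (a%:Z - 2) * (multiplicity a n c)%:Z - 2 <= b ->
  (0 < gens a c b i)%N /\
  (gens a c b i)%:Z = (multiplicity a n c)%:Z + step a n c b * (repunit a i)%:Z.
Proof.
move=> ha hn hc hb; have h1 := mult_ge ha hn hc; have h2 := step_ge ha hn hc hb.
have h3 : 0 <= step a n c b * (repunit a i)%:Z by apply: mulr_ge0; lia.
by rewrite /gens; lia.
Qed.

Lemma corner_expE (a n c : nat) (b : int) :
  (2 <= a)%N -> (3 <= n)%N -> (1 <= c)%N ->
  - (a%:Z - 2) * (multiplicity a n c)%:Z - 2 <= b ->
  (corner_exp a n c b)%:Z = step a n c b + c%:Z + 1 - a%:Z.
Proof.
by move=> ha hn hc hb; have := step_ge ha hn hc hb; rewrite /corner_exp; lia.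
Qed.

Lemma generated_numerical_semigroup (a n c : nat) (b : int) :
  (2 <= a)%N -> (3 <= n)%N -> (1 <= c)%N ->
  - (a%:Z - 2) * (multiplicity a n c)%:Z - 2 <= b ->
  gcdz (multiplicity a n c)%:Z b = 1 ->
  numerical_semigroup (gen_semigroup (@gens a n c b)).
Proof.
move=> ha hn hc hb hg; pose s := @gens a n c b.
split.
- by exists [ffun=> 0%N]; rewrite /factorization big1 // => i _; rewrite ffunE.
- move=> x y [u ->] [v ->]; exists [ffun i => u i + v i]%N.
  rewrite /factorization -big_split /=; apply: eq_bigr => i _.
  by rewrite ffunE mulnDl.
have hn0 : (0 < n)%N by lia.
have hn1 : (1 < n)%N by lia.
pose i0 := Ordinal hn0; pose i1 := Ordinal hn1; pose m := multiplicity a n c.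
have [p0 E0] := gens_pos i0 ha hn hc hb.
have [p1 E1] := gens_pos i1 ha hn hc hb.
rewrite -/s -/m in p0 E0 p1 E1.
have r0 : repunit a i0 = 0%N by rewrite /repunit /= expn0 div0n.
have r1 : repunit a i1 = 1%N.
  by rewrite /= repunitS // -[repunit a 0]/(repunit a i0) r0; lia.
have hco : coprime (s i0) (s i1).
  have : gcdz (s i0)%:Z (s i1)%:Z = 1.
    rewrite E0 E1 r0 r1 mulr0 addr0 mulr1 /step -/m.
    rewrite (_ : m%:Z + _ = a%:Z * m%:Z + b); last by lia.
    by rewrite gcdzMDl.
  by rewrite /gcdz /= /coprime => -[->].
exists (iota 0 (s i0 * s i1)) => x hx; rewrite mem_iota add0n /= ltnNge.
apply/negP => le_x; apply: hx.
pose y := (chinese (s i0) (s i1) x 0 %% (s i0 * s i1))%N.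
have y1 : (s i1 %| y)%N.
  rewrite /dvdn /y modn_dvdm ?dvdn_mull //.
  by rewrite chinese_modr // mod0n.
have y0 : (y = x %[mod s i0])%N.
  by rewrite /y modn_dvdm ?dvdn_mulr // chinese_modl.
have yx : (y <= x)%N.
  by apply: leq_trans le_x; apply: ltnW; rewrite ltn_pmod // muln_gt0 p0.
have d0 : (s i0 %| x - y)%N by rewrite -eqn_mod_dvd //; apply/eqP.
exists [ffun i => if i == i0 then (x - y) %/ s i0
                  else if i == i1 then y %/ s i1 else 0]%N.
rewrite /factorization (bigD1 i0) //= (bigD1 i1) //= !ffunE !eqxx /=.
rewrite -/(s i0) -/(s i1) !divnK // big1 ?addn0 ?subnK //.
by move=> i /andP[/negPf n0 /negPf n1]; rewrite ffunE n0 n1.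
Qed.

(* Main.v *)
(** Write F_j and G_j for the entries of the first and second row in column j.
   They are powers of variables, and deg G_j - deg F_j = b for all j. Hence,
   modulo I_2, the monomial G_i F_j (i < j) may be replaced by F_i G_j, which has
   the same degree and a larger weight for a second grading om chosen so that
   om(G_j) - om(F_j) is strictly increasing in j. So every monomial is congruent
   to a standard one, i.e. one divisible by no G_i F_j with i < j. Up to powers
   of X_1 the standard monomials are the greedy expansions of 0, ..., m - 1 in
   the A_i, so their degrees are pairwise distinct. This gives I_H = I_2 and the
   Apery set of H with respect to m. The maximal standard monomials without X_1
   are X_j^a X_(j+1)^(a-1) ... X_(n-1)^(a-1) X_n^(c-1) (and X_n^c); their degrees
   form an arithmetic progression of difference b, whence PF(H). The number h is
   the degree of a monomial divisible by no F_j (if b > 0) or by no G_j (if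
   b < 0), and such a monomial occurs in no element of I_2.

   For the exactness of the Eagon-Northcott complex, give X^u e_I (x) u_j the
   multidegree X^u prod_(t in P) G_t prod_(t in I - P) F_t, where P consists of
   the first j + 1 elements of I. Each term of the differential either preserves
   the multidegree or raises its om-weight. Match terms of equal multidegree by
   adding to I or removing from I the least column p with G_p dividing the
   multidegree or, if j = 0 and p is already in I, the greatest column q > p with
   G_p F_q dividing it. For a suitable refinement of the om-order the leading
   term of the boundary of a matched term is its partner, so cycles reduce to 0
   modulo boundaries as in Groebner basis theory. *)
Require Import Defs.
From mathcomp Require Import all_boot all_order all_algebra.
From mathcomp Require Import mpoly zify ring.

Set Implicit Arguments.
Unset Strict Implicit.
Unset Printing Implicit Defensive.

Import Order.TTheory GRing.Theory Num.Theory.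
Local Open Scope ring_scope.

(** * Ideals and free modules *)

Section IdealGen.

Variables (R : comNzRingType) (P : R -> Prop).

Lemma ideal_gen0 : ideal_gen P 0.
Proof. by exists [::]; rewrite ?big_nil. Qed.

Lemma ideal_genD f g : ideal_gen P f -> ideal_gen P g -> ideal_gen P (f + g).
Proof.
move=> [l Pl ->] [l' Pl' ->]; exists (l ++ l'); last by rewrite big_cat.
by move=> x; rewrite mem_cat => /orP[/Pl|/Pl'].
Qed.

Lemma ideal_genMl r f : ideal_gen P f -> ideal_gen P (r * f).
Proof.
move=> [l Pl ->]; exists [seq (r * x.1, x.2) | x <- l].
  by move=> _ /mapP[x /Pl Px ->].
by rewrite big_map big_distrr; apply: eq_bigr => x _ /=; rewrite mulrA.
Qed.

Lemma ideal_genN f : ideal_gen P f -> ideal_gen P (- f).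
Proof. by rewrite -mulN1r; apply: ideal_genMl. Qed.

Lemma ideal_genB f g : ideal_gen P f -> ideal_gen P g -> ideal_gen P (f - g).
Proof. by move=> Pf /ideal_genN; apply: ideal_genD. Qed.

Lemma ideal_gen_sum (I : Type) (r : seq I) (Q : pred I) (F : I -> R) :
  (forall i, Q i -> ideal_gen P (F i)) -> ideal_gen P (\sum_(i <- r | Q i) F i).
Proof. by move=> PF; elim/big_ind: _ => //; [apply: ideal_gen0 | apply: ideal_genD]. Qed.

Lemma mem_ideal_gen f : P f -> ideal_gen P f.
Proof.
by move=> Pf; exists [:: (1, f)]; rewrite ?big_seq1 ?mul1r // => x /[!inE]/eqP->.
Qed.

Lemma ideal_gen_least (Q : R -> Prop) :
    Q 0 -> (forall f g, Q f -> Q g -> Q (f + g)) ->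
    (forall r f, P f -> Q (r * f)) ->
  forall f, ideal_gen P f -> Q f.
Proof.
move=> Q0 QD QM f [l Pl ->]; rewrite big_seq.
by elim/big_ind: _ => // x /Pl; apply: QM.
Qed.

End IdealGen.

Lemma I2_least (R : comNzRingType) (n : nat) (M : 'M[R]_(2, n)) (Q : R -> Prop) :
    Q 0 -> (forall f g, Q f -> Q g -> Q (f + g)) ->
    (forall r (p q : 'I_n), (p < q)%N -> Q (r * minor2 M 0 1 p q)) ->
  forall f, I2 M f -> Q f.
Proof.
move=> Q0 QD QM; apply: ideal_gen_least => // r _ [i1 [i2 [p [q [lt_i pq ->]]]]].
have [-> ->] : i1 = 0 /\ i2 = 1.
  by move: i1 i2 lt_i => [[|[|//]] ?] [[|[|//]] ?] //= _; split; apply: val_inj.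
exact: QM.
Qed.

Section FreeMap.

Variables (R : comNzRingType) (B C : finType) (M : B -> C -> R).

Lemma free_map0 : free_map M 0 = 0.
Proof. by apply/ffunP => y; rewrite !ffunE big1 // => x _; rewrite ffunE mul0r. Qed.

Lemma free_mapD u v : free_map M (u + v) = free_map M u + free_map M v.
Proof.
apply/ffunP => y; rewrite !ffunE -big_split /=.
by apply: eq_bigr => x _; rewrite ffunE mulrDl.
Qed.

Lemma free_mapB u v : free_map M (u - v) = free_map M u - free_map M v.
Proof.
apply/ffunP => y; rewrite !ffunE -sumrN -big_split /=.
by apply: eq_bigr => x _; rewrite !ffunE mulrBl.
Qed.

Lemma free_map_comp (D : finType) (N : D -> B -> R) :
  (forall z y, \sum_x N z x * M x y = 0) ->
  forall u, free_map M (free_map N u) = 0.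
Proof.
move=> NM u; apply/ffunP => y; rewrite !ffunE.
under eq_bigr => x _ do rewrite ffunE big_distrl /=.
rewrite exchange_big big1 //= => z _.
by under eq_bigr => x _ do rewrite -mulrA; rewrite -big_distrr /= NM mulr0.
Qed.

End FreeMap.

(** * Terms and leading terms of maps of free modules *)

Section Terms.

Variables (k : fieldType) (n : nat).
Local Notation R := {mpoly k[n]}.
Local Notation term B := ('X_{1..n} * B)%type.

Definition coef_at (B : finType) (v : {ffun B -> R}) (t : term B) : k :=
  (v t.2)@_t.1.

Definition term_vec (B : finType) (t : term B) : {ffun B -> R} :=
  [ffun x => if x == t.2 then 'X_[t.1] else 0].

Definition term_supp (B : finType) (v : {ffun B -> R}) : seq (term B) :=
  [seq (m, x) | x <- enum B, m <- msupp (v x)].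

(* The coefficient at the term [t'] of the image of the term [t]. *)
Definition term_coef (B C : finType) (M : B -> C -> R) (t : term B) (t' : term C)
    : k :=
  ('X_[t.1] * M t.2 t'.2)@_t'.1.

Lemma mem_term_supp (B : finType) (v : {ffun B -> R}) t :
  (t \in term_supp v) = (coef_at v t != 0).
Proof.
rewrite /coef_at -mcoeff_msupp; apply/allpairsPdep/idP => [[x [m []]] | mt].
  by move=> _ mm -> /=.
by exists t.2, t.1; rewrite mem_enum; split=> //; case: t {mt}.
Qed.

Lemma term_supp_uniq (B : finType) (v : {ffun B -> R}) : uniq (term_supp v).
Proof.
apply: allpairs_uniq_dep => [|x _|]; rewrite ?enum_uniq ?msupp_uniq //.
by move=> [x m] [y m'] _ _ /= [-> ->].
Qed.

Lemma term_supp0 (B : finType) (v : {ffun B -> R}) :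
  (forall t, coef_at v t = 0) -> v = 0.
Proof.
by move=> v0; apply/ffunP => x; apply/mpolyP => m; rewrite ffunE mcoeff0 -(v0 (m, x)).
Qed.

Lemma coef_at_free_map (B C : finType) (M : B -> C -> R) v t' :
  coef_at (free_map M v) t' =
  \sum_(t <- term_supp v) coef_at v t * term_coef M t t'.
Proof.
rewrite /coef_at ffunE raddf_sum big_allpairs_dep /= big_enum /=.
apply: eq_bigr => x _; rewrite {1}[v x]mpolyE big_distrl raddf_sum /=.
by apply: eq_bigr => m _; rewrite -scalerAl mcoeffZ.
Qed.

Lemma coef_at_free_map_term (B C : finType) (M : B -> C -> R) c t t' :
  coef_at (free_map M (c *: term_vec t)) t' = c * term_coef M t t'.
Proof.
rewrite /coef_at ffunE (bigD1 t.2) //= big1 ?addr0.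
  by rewrite !ffunE eqxx -scalerAl mcoeffZ.
by move=> x /negPf xt; rewrite !ffunE xt scaler0 mul0r.
Qed.

Lemma coef_atB (B : finType) (u v : {ffun B -> R}) t :
  coef_at (u - v) t = coef_at u t - coef_at v t.
Proof. by rewrite /coef_at !ffunE mcoeffB. Qed.

Lemma coef_atD (B : finType) (u v : {ffun B -> R}) t :
  coef_at (u + v) t = coef_at u t + coef_at v t.
Proof. by rewrite /coef_at !ffunE mcoeffD. Qed.

(** Leading means strictly least for [mu], since the rewriting in use raises weights. *)
Definition lead_term (B C : finType) (M : B -> C -> R) (mu : term C -> nat)
    (t : term B) (t' : term C) : Prop :=
  term_coef M t t' != 0 /\
  forall t'', term_coef M t t'' != 0 -> t'' = t' \/ (mu t' < mu t'')%N.

Lemma lead_term_uniq (B C : finType) (M : B -> C -> R) mu t t1 t2 :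
  lead_term M mu t t1 -> lead_term M mu t t2 -> t1 = t2.
Proof.
move=> [nz1 min1] [nz2 min2].
by case: (min1 _ nz2) (min2 _ nz1) => [->//|lt12] [//|/(ltn_trans lt12)]; rewrite ltnn.
Qed.

(** * Exactness from a matching of terms *)

Section Exactness.

Variables (A B D : finType) (M : B -> A -> R) (N : D -> B -> R).
Variables (muA : term A -> nat) (muB wt : term B -> nat) (up : pred (term B)).

Hypothesis MN0 : forall u, free_map M (free_map N u) = 0.
Hypothesis lead_down : forall t, ~~ up t -> exists t', lead_term M muA t t'.
Hypothesis lead_inj : forall t1 t2 t', ~~ up t1 -> ~~ up t2 ->
  lead_term M muA t1 t' -> lead_term M muA t2 t' -> t1 = t2.
Hypothesis lead_up : forall t, up t -> exists2 z, lead_term N muB z t &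
  forall t', term_coef N z t' != 0 -> wt t' = wt t.
Hypothesis mu_bounded : forall w, exists K, forall t,
  (wt t <= w)%N -> (muB t < K)%N.

(** In the support take a term whose leading term [t'] has least [muA]. Any other term of the
    support that reached [t'] would have the same leading term, against [lead_inj], or one of
    smaller [muA]. So the coefficient at [t'] cannot cancel. *)
Lemma cycle_without_up v :
  (forall t, coef_at v t != 0 -> ~~ up t) -> free_map M v = 0 -> v = 0.
Proof.
move=> upv Mv0; apply: term_supp0 => t; apply/eqP; apply: contraT => vt.
have [t' lt] := lead_down (upv _ vt).
elim/ltn_ind: {t'}(muA t') {-2}t' (erefl (muA t')) t vt lt => r IH t' def_r t vt lt.
have := coef_at_free_map M v t'; rewrite Mv0 {1}/coef_at ffunE mcoeff0.
rewrite (bigD1_seq t) ?mem_term_supp ?term_supp_uniq //= big_seq_cond big1.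
  move=> /esym/eqP; rewrite addr0 mulf_eq0 (negPf vt) /=.
  by case: lt => /negPf->.
move=> s /andP[]; rewrite mem_term_supp => vs st; apply/eqP; rewrite mulf_eq0.
apply/orP; right; apply: contraT => Mst.
have [s' ls] := lead_down (upv _ vs); have [_ /(_ _ Mst)] := ls.
case=> [e|lts]; last by rewrite def_r in lts; apply: (IH _ lts s' (erefl _) s vs ls).
by move: st; rewrite (lead_inj (upv _ vs) (upv _ vt) ls) ?eqxx // -e.
Qed.

(** Induction on [l]: a multiple of the term [z] matched with [t] sets the coefficient at [t]. As
    [t] leads the image of [z], every other coefficient affected lies at a level above [r], and all
    these terms have the weight of [t]. *)
Lemma clear_level (c : term B -> k) r w (l : seq (term B)) :
    uniq l -> (forall t, t \in l -> [/\ up t, muB t = r & (wt t <= w)%N]) ->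
  exists u, forall t,
    [/\ coef_at (free_map N u) t != 0 -> (wt t <= w)%N,
        coef_at (free_map N u) t != 0 -> (r <= muB t)%N
      & muB t = r -> coef_at (free_map N u) t = (t \in l)%:R * c t].
Proof.
elim: l => [_ _|t l IH /= /andP[tl ul] Pl].
  by exists 0 => t; rewrite free_map0 /coef_at ffunE mcoeff0 eqxx mul0r.
have [|u Pu] := IH ul; first by move=> s sl; apply: Pl; rewrite inE sl orbT.
have [upt mut wtt] := Pl _ (mem_head _ _).
have [z [Nzt Nz] Nzw] := lead_up upt.
exists (u + (c t / term_coef N z t) *: term_vec z) => s; have [Pu1 Pu2 Pu3] := Pu s.
rewrite free_mapD coef_atD coef_at_free_map_term.
have [Nzs|Nzs] := eqVneq (term_coef N z s) 0.
  rewrite Nzs mulr0 addr0; split=> // /Pu3->; rewrite inE.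
  by case: eqP => // e; rewrite -e Nzs eqxx in Nzt.
split=> [_|_|mus]; first by rewrite Nzw.
  by case: (Nz _ Nzs) => [->|]; rewrite mut // => /ltnW.
case: (Nz _ Nzs) => [e|]; last by rewrite mut mus ltnn.
by rewrite Pu3 // e inE eqxx (negPf tl) mul0r add0r mul1r divfK.
Qed.

(** Boundaries clear the [up] terms level by level, from below. The weight bound [w] survives each
    subtraction, so all levels stay under one [K], and what remains in the end is a cycle free of
    [up] terms. *)
Lemma cycle_boundary v :
  free_map M v = 0 -> exists u, v = free_map N u.
Proof.
pose w := (\max_(t <- term_supp v) wt t)%N.
have: forall t, coef_at v t != 0 -> (wt t <= w)%N.
  by move=> t vt; apply: leq_bigmax_seq; rewrite ?mem_term_supp.
have [K muK] := mu_bounded w.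
have: forall t, coef_at v t != 0 -> up t -> (K - K <= muB t)%N by rewrite subnn.
elim: {3}K v w muK => [|r IH] v w muK upv wv Mv0.
  exists 0; rewrite free_map0; apply: cycle_without_up => // t vt.
  by apply/negP => /(upv _ vt); rewrite leqNgt subn0 muK // wv.
pose l := [seq t <- term_supp v | up t && (muB t == K - r.+1)%N].
have [||u Pu] := @clear_level (coef_at v) (K - r.+1) w l.
- by rewrite filter_uniq ?term_supp_uniq.
- move=> t; rewrite mem_filter mem_term_supp => /andP[/andP[-> /eqP->] vt].
  by split=> //; apply: wv.
have [| | |u' def_v] := IH (v - free_map N u) w muK.
- move=> t; rewrite coef_atB => vut upt; have [_ Pu2 Pu3] := Pu t.
  have: (K - r.+1 <= muB t)%N.
    by have [v0|/upv->//] := eqVneq (coef_at v t) 0; apply: Pu2; rewrite v0 sub0r oppr_eq0 in vut.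
  rewrite leq_eqVlt => /orP[/eqP e|]; last by lia.
  case/negP: vut; rewrite Pu3 // mem_filter mem_term_supp upt e eqxx /=.
  by have [->|_] := eqVneq (coef_at v t) 0; rewrite /= ?mulr0 ?mul1r subrr.
- move=> t; rewrite coef_atB => vut; have [Pu1 _ _] := Pu t.
  have [v0|/wv//] := eqVneq (coef_at v t) 0.
  by apply: Pu1; rewrite v0 sub0r oppr_eq0 in vut.
- by rewrite free_mapB Mv0 MN0 subrr.
by exists (u' + u); rewrite free_mapD -def_v subrK.
Qed.

End Exactness.
End Terms.

(** * The Eagon-Northcott differential *)

Section OrdinalSets.

Variable n : nat.
Implicit Types (I J : {set 'I_n}) (s t p q : 'I_n).

Definition set_rank I s : nat := #|[set t in I | (t < s)%N]|.

Lemma set_minP I p0 : p0 \in I -> exists2 p, p \in I & forall s, s \in I -> (p <= s)%N.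
Proof.
move=> Ip0; case: (@arg_minnP _ p0 (mem I) val Ip0) => p Ip minp.
by exists p.
Qed.

Lemma set_rankD1 I s t : s \in I -> set_rank I t = ((s < t) + set_rank (I :\ s) t)%N.
Proof.
move=> Is; rewrite /set_rank; case: ltnP => st; last first.
  apply: eq_card => u; rewrite !inE; case: eqP => // ->.
  by rewrite Is ltnNge st.
rewrite (cardsD1 s) !inE Is st; congr (_ + _)%N; apply: eq_card => u.
by rewrite !inE andbA.
Qed.

Lemma cards2_lt I : #|I| = 2%N -> exists p q, (p < q)%N /\ I = [set p; q].
Proof.
move=> /eqP/cards2P[p [q [pq ->]]]; case: (ltngtP p q) => [lt|lt|/val_inj e].
- by exists p, q.
- by exists q, p; rewrite setUC.
by rewrite e eqxx in pq.
Qed.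

Lemma cards3_lt I : #|I| = 3%N ->
  exists p q s, [/\ (p < q)%N, (q < s)%N & I = [set p; q; s]].
Proof.
move=> I3; have /card_gt0P[p0 /set_minP[p Ip minp]] : (0 < #|I|)%N by rewrite I3.
have /cards2_lt[q [s [qs def_I]]] : #|I :\ p| = 2%N.
  by move: I3; rewrite (cardsD1 p) Ip => -[].
exists p, q, s; split=> //; last by rewrite -(setD1K Ip) def_I setUA.
have /setD1P[qp Iq] : q \in I :\ p by rewrite def_I set21.
by rewrite ltn_neqAle minp // eq_sym andbT; apply: contra qp => /eqP/val_inj->.
Qed.

End OrdinalSets.

(** [h s t] splits as [g s t - g t s] with [g] supported on [s < t], and the two double sums agree.
    Halving would fail in characteristic 2. *)
Lemma sum_antisym (R : zmodType) (n : nat) (h : 'I_n -> 'I_n -> R) :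
  (forall s, h s s = 0) -> (forall s t, h s t = - h t s) ->
  \sum_s \sum_t h s t = 0.
Proof.
move=> h0 hN; pose g (s t : 'I_n) := if (s < t)%N then h s t else 0.
have hE s t : h s t = g s t - g t s.
  rewrite /g; case: (ltngtP s t) => [_|_|/val_inj->]; rewrite ?subr0 ?sub0r ?h0 //.
under eq_bigr => s _ do under eq_bigr => t _ do rewrite hE.
under eq_bigr => s _ do rewrite sumrB.
by rewrite sumrB [X in _ - X]exchange_big subrr.
Qed.

#[local] Arguments EN_diff_coef : simpl never.

Section EagonNorthcott.

Variables (R : comNzRingType) (n : nat) (M : 'M[R]_(2, n)).

Definition contraction_coef (s : 'I_n) (j l : nat) : R :=
  M 0 s * (l == j)%:R + M 1 s * (l.+1 == j)%:R.

Lemma EN_coefE i (x : EN_basis n i.+2) (y : EN_basis n i.+1) :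
  EN_diff_coef M x y =
  \sum_(s in val x.1 | val x.1 :\ s == val y.1) (-1) ^+ set_rank (val x.1) s *
     contraction_coef s x.2 y.2.
Proof.
apply: eq_bigr => s _; rewrite /contraction !mxE /=.
by congr (_ * (_ * _%:R + _ * _%:R)).
Qed.

Lemma EN_coef_row i (x : EN_basis n i.+2) (y : EN_basis n i.+1) s :
    s \in val x.1 -> val y.1 = val x.1 :\ s ->
  EN_diff_coef M x y = (-1) ^+ set_rank (val x.1) s * contraction_coef s x.2 y.2.
Proof.
move=> Is def_y; rewrite EN_coefE (eq_bigl (pred1 s)) ?big_pred1_eq // => t.
rewrite def_y inE; apply/andP/eqP => [[It /eqP e]|-> //].
have: t \notin val x.1 :\ s by rewrite -e !inE eqxx.
by rewrite !inE It andbT negbK => /eqP.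
Qed.

Lemma EN_coef_neq0 i (x : EN_basis n i.+2) (y : EN_basis n i.+1) :
    EN_diff_coef M x y != 0 ->
  exists2 s, s \in val x.1 & val y.1 = val x.1 :\ s.
Proof.
rewrite EN_coefE => nz.
case: (pickP (fun s => (s \in val x.1) && (val x.1 :\ s == val y.1))).
  by move=> s /andP[Is /eqP <-]; exists s.
by move=> no_s; rewrite big_pred0 ?eqxx in nz.
Qed.

Lemma wedge2_pair (p q : 'I_n) : (p < q)%N ->
  wedge2_map M [set p; q] = minor2 M 0 1 p q.
Proof.
move=> pq; have npq : p != q by apply: contraTneq pq => ->; rewrite ltnn.
rewrite /wedge2_map big_setU1 ?inE //= big_set1.
rewrite (bigD1 q) /=; last by rewrite !inE eqxx orbT.
rewrite !big1 ?addr0 // => i /andP[]; rewrite !inE.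
  by case/orP=> /eqP->; rewrite ?ltnn // ltnNge (ltnW pq).
by case/andP=> /orP[]/eqP->; rewrite ?ltnn ?eqxx // pq andbF.
Qed.

Lemma sum_basis i (F : EN_basis n i.+1 -> R) (J : {I : {set 'I_n} | #|I| == i.+2}) :
  \sum_(x : EN_basis n i.+1 | val J == val x.1) F x = \sum_l F (J, l).
Proof.
transitivity (\sum_(u | u == J) \sum_l F (u, l)); last by rewrite big_pred1_eq.
rewrite pair_big.
by apply: eq_big => [x|[]//]; rewrite andbT (inj_eq val_inj) eq_sym.
Qed.

(** Two contractions amount to one by the product in [Sym G], which is commutative: the closed form
    [E] is symmetric in [u] and [v]. *)
Lemma contraction_coefC i (j : 'I_i.+3) (l : 'I_i.+1) s t :
  \sum_(h < i.+2) contraction_coef s j h * contraction_coef t h l =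
  \sum_(h < i.+2) contraction_coef t j h * contraction_coef s h l.
Proof.
suff E u v : \sum_(h < i.+2) contraction_coef u j h * contraction_coef v h l =
    M 0 u * M 0 v * (l == j :> nat)%:R
    + (M 0 u * M 1 v + M 1 u * M 0 v) * (l.+1 == j)%:R
    + M 1 u * M 1 v * (l.+2 == j)%:R.
  by rewrite !E; ring.
rewrite (bigD1 (widen_ord (leqnSn _) l)) //= (bigD1 (lift ord0 l)) /=; last first.
  by rewrite -val_eqE /= /bump /= add1n neq_ltn ltnSn orbT.
rewrite /contraction_coef /bump /= !add1n !eqxx (gtn_eqF (ltnSn l)).
rewrite (ltn_eqF (ltnSn l)) big1 ?addr0; first by rewrite /= mulr1n mulr0n; ring.
move=> h /andP[]; rewrite -!val_eqE /= /bump /= add1n !(eq_sym (h : nat)) => /negPf h1 /negPf h2.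
by rewrite h1 h2 !mulr0 addr0 mulr0.
Qed.

(** Deleting [s] and [t] in either order gives the same contraction, while the sum of the two ranks
    changes by one. So the summands are antisymmetric. *)
Lemma EN_comp_higher i (z : EN_basis n i.+3) (y : EN_basis n i.+1) :
  \sum_(x : EN_basis n i.+2) EN_diff_coef M z x * EN_diff_coef M x y = 0.
Proof.
pose I := val z.1; have cardI : #|I| = i.+4 := eqP (valP z.1).
pose C s t := \sum_(l < i.+2) contraction_coef s z.2 l * contraction_coef t l y.2.
pose h s t := if [&& s \in I, t \in I :\ s & I :\ s :\ t == val y.1]
  then (-1) ^+ (set_rank I s + set_rank (I :\ s) t) * C s t else 0.
transitivity (\sum_s \sum_t h s t).
  under eq_bigr => x _ do rewrite EN_coefE big_distrl /=.
  rewrite (exchange_big_dep (mem I)) /=; last by move=> x s _ /andP[].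
  rewrite [LHS]big_mkcond; apply: eq_bigr => s _; rewrite /h.
  case: ifP => Is /=; last by rewrite big1.
  have cIs : #|I :\ s| == i.+3 by rewrite -eqSS -cardI (cardsD1 s I) Is.
  rewrite (eq_bigl (fun x : EN_basis n i.+2 => I :\ s == val x.1)); last first.
    by move=> x; rewrite -/I Is.
  pose J : {J : {set 'I_n} | #|J| == i.+3} := exist _ (I :\ s) cIs.
  rewrite (sum_basis _ J) /=.
  under eq_bigr => l _ do rewrite EN_coefE big_distrr /=.
  rewrite exchange_big /= big_mkcond; apply: eq_bigr => t _.
  case: ifP => // _; rewrite /C big_distrr /=; apply: eq_bigr => l _.
  by rewrite exprD /I; ring.
apply: sum_antisym => [s|s t]; rewrite /h; first by rewrite !inE eqxx andbF.
rewrite !inE [t == s]eq_sym.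
have -> : I :\ s :\ t = I :\ t :\ s by rewrite setDDl setUC -setDDl.
case: (eqVneq s t) => [->|nst] /=; first by rewrite !andbF oppr0.
case Is: (s \in I); case It: (t \in I) => /=; rewrite ?oppr0 //.
case: ifP => _; rewrite ?oppr0 // /C contraction_coefC -/(C t s).
rewrite (set_rankD1 t Is) (set_rankD1 s It).
case: (ltngtP s t) nst => [_|_|/val_inj->]; rewrite ?eqxx // => _.
  by rewrite !exprD /= expr0 expr1; ring.
by rewrite !exprD /= expr0 expr1; ring.
Qed.

(** For three columns the sum is the expansion of a 3 by 3 determinant whose first row, the row
    [z.2] of [M], occurs again below. *)
Lemma EN_comp_first (z : EN_basis n 2) (y : EN_basis n 0) :
  \sum_(x : EN_basis n 1) EN_diff_coef M z x * EN_diff_coef M x y = 0.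
Proof.
pose I := val z.1; have cardI : #|I| = 3%N := eqP (valP z.1).
transitivity (\sum_(s in I) (-1) ^+ set_rank I s *
    contraction_coef s z.2 0 * wedge2_map M (I :\ s)).
  under eq_bigr => x _ do rewrite EN_coefE big_distrl /=.
  rewrite (exchange_big_dep (mem I)) /=; last by move=> x s _ /andP[].
  apply: eq_bigr => s Is.
  have cIs : #|I :\ s| == 2%N by rewrite -eqSS -cardI (cardsD1 s I) Is.
  rewrite (eq_bigl (fun x : EN_basis n 1 => I :\ s == val x.1)); last first.
    by move=> x; rewrite -/I Is.
  pose J : {J : {set 'I_n} | #|J| == 2%N} := exist _ (I :\ s) cIs.
  by rewrite (sum_basis _ J) big_ord1.
have [p [q [s [pq qs def_I]]]] := cards3_lt cardI; rewrite def_I.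
have [npq nqs nps] : [/\ p != q, q != s & p != s].
  by rewrite -!val_eqE /=; split; lia.
have Dp : [set p; q; s] :\ p = [set q; s].
  apply/setP => u; rewrite !inE; case: (eqVneq u p) => [->|_] //=.
  by rewrite (negPf npq) (negPf nps).
have Dq : [set p; q; s] :\ q = [set p; s].
  apply/setP => u; rewrite !inE; case: (eqVneq u q) => [->|_] //=.
    by rewrite eq_sym (negPf npq) (negPf nqs).
  by rewrite orbF.
have Ds : [set p; q; s] :\ s = [set p; q].
  apply/setP => u; rewrite !inE; case: (eqVneq u s) => [->|_] /=.
    by rewrite eq_sym (negPf nps) eq_sym (negPf nqs).
  by rewrite orbF.
have rp : set_rank [set p; q; s] p = 0%N.
  by apply: eq_card0 => u; rewrite !inE -!val_eqE /=; lia.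
have rq : set_rank [set p; q; s] q = 1%N.
  rewrite /set_rank (_ : [set _ in _ | _] = [set p]) ?cards1 //.
  by apply/setP => u; rewrite !inE -!val_eqE /=; lia.
have rs : set_rank [set p; q; s] s = 2%N.
  rewrite /set_rank (_ : [set _ in _ | _] = [set p; q]) ?cards2 ?npq //.
  by apply/setP => u; rewrite !inE -!val_eqE /=; lia.
rewrite -setUA !big_setU1 ?inE ?negb_or ?npq //= big_set1 setUA.
rewrite Dp Dq Ds rp rq rs !wedge2_pair //; last by lia.
rewrite /minor2 /contraction_coef.
case: z.2 => -[|[|//]] lt2 /=; ring.
Qed.

End EagonNorthcott.

(** * Weighted degrees and initial segments *)

Section Weights.

Variable n : nat.
Implicit Types (m : 'X_{1..n}) (w : 'I_n -> nat).

Lemma wdegD w m1 m2 : wdeg w (m1 + m2)%MM = (wdeg w m1 + wdeg w m2)%N.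
Proof. by rewrite /wdeg -big_split; apply: eq_bigr => i _; rewrite mnmDE mulnDl. Qed.

Lemma wdeg0 w : wdeg w 0%MM = 0%N.
Proof. by rewrite /wdeg big1 // => i _; rewrite mnm0E. Qed.

Lemma wdegMn w m e : wdeg w (m *+ e)%MM = (e * wdeg w m)%N.
Proof.
rewrite /wdeg big_distrr; apply: eq_bigr => i _ /=.
by rewrite mulmnE mulnCA mulnA.
Qed.

Lemma wdegU w i : wdeg w U_(i)%MM = w i.
Proof.
rewrite /wdeg (bigD1 i) //= big1 ?addn0 => [|j /negPf ji].
  by rewrite mnm1E eqxx mul1n.
by rewrite mnm1E eq_sym ji.
Qed.

Lemma wdeg_sum w (I : Type) (r : seq I) (P : pred I) (f : I -> 'X_{1..n}) :
  wdeg w (\sum_(i <- r | P i) f i)%MM = (\sum_(i <- r | P i) wdeg w (f i))%N.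
Proof. by elim/big_rec2: _ => [|i _ m _ <-]; rewrite ?wdeg0 ?wdegD. Qed.

Lemma lepm_pow i e m : (U_(i) *+ e <= m)%MM = (e <= m i)%N.
Proof.
apply/mnm_lepP/idP => [/(_ i)|em j]; rewrite mulmnE mnm1E ?eqxx ?mul1n //.
by case: eqP => [<-|]; rewrite ?mul1n.
Qed.

(** Positive weights [s i] bound each exponent by [wdeg s m]. Hence any rewriting that keeps the
    [s]-degree and raises another weight must stop. *)
Lemma wdeg_bound w s : (forall i, (0 < s i)%N) ->
  forall m, (wdeg w m <= (\sum_i w i) * wdeg s m)%N.
Proof.
move=> s0 m; rewrite big_distrl; apply: leq_sum => i _ /=.
rewrite mulnC leq_mul2l; apply/orP; right.
by rewrite /wdeg (bigD1 i) //= (leq_trans _ (leq_addr _ _)) // leq_pmulr.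
Qed.

End Weights.

Section FirstElements.

Variable n : nat.
Implicit Types (I J : {set 'I_n}) (s t p q : 'I_n) (k : nat).

Definition first_elts I k : {set 'I_n} := [set t in I | (set_rank I t < k)%N].

Lemma first_elts_sub I k : first_elts I k \subset I.
Proof. by apply/subsetP => t; rewrite inE => /andP[]. Qed.

Lemma set_rank_le I s t : (s <= t)%N -> (set_rank I s <= set_rank I t)%N.
Proof.
move=> st; apply/subset_leq_card/subsetP => u; rewrite !inE => /andP[->] /=.
by move=> /leq_trans->.
Qed.

Lemma first_elts_lt I k p q :
  p \in first_elts I k -> q \in I -> q \notin first_elts I k -> (p < q)%N.
Proof.
rewrite !inE => /andP[Ip pk] -> /=; rewrite -leqNgt => kq; rewrite ltnNge.
by apply/negP => /(@set_rank_le I)/(leq_trans kq); rewrite leqNgt pk.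
Qed.

Lemma set_rank_lt_card I s : s \in I -> (set_rank I s < #|I|)%N.
Proof.
move=> Is; rewrite [X in (_ < X)%N](cardsD1 s) Is add1n ltnS.
apply/subset_leq_card/subsetP => t; rewrite !inE => /andP[-> ts].
by rewrite andbT -val_eqE /= neq_ltn ts.
Qed.

Lemma card_first_elts I k : (k <= #|I|)%N -> #|first_elts I k| = k.
Proof.
move: {2}#|I| (erefl #|I|) => r; elim: r I => [|r IH] I cardI.
  rewrite cardI leqn0 => /eqP->; apply: eq_card0 => t.
  by rewrite !inE ltn0 andbF.
rewrite leq_eqVlt => /orP[/eqP->|ltk].
  by apply: eq_card => t; rewrite inE; case: (boolP (t \in I)) => // /set_rank_lt_card->.
have /card_gt0P[q' Iq'] : (0 < #|I|)%N by rewrite cardI.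
case: (@arg_maxnP _ q' (mem I) val Iq') => q /= Iq maxq.
have cIq : #|I :\ q| = r by move: cardI; rewrite (cardsD1 q) Iq => -[].
rewrite -{2}(IH (I :\ q)) //; last by rewrite cIq -ltnS -cardI.
apply: eq_card => t; rewrite !inE; case: (eqVneq t q) => [->|nt] /=.
  rewrite Iq (_ : set_rank I q = r) ?ltnNge; first by rewrite -ltnS -cardI ltk.
  rewrite -cIq; apply: eq_card => u; rewrite !inE -val_eqE /= andbC.
  by case: (boolP (u \in I)) => [/maxq|]; rewrite ?andbF // !andbT ltn_neqAle => ->; rewrite andbT.
case: (boolP (t \in I)) => //= /maxq le_tq.
by rewrite (set_rankD1 t Iq) (ltnNge q) le_tq.
Qed.

Lemma first_elts0 I : first_elts I 0 = set0.
Proof. by apply/setP => t; rewrite !inE andbF. Qed.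

Lemma first_eltsS I p k : p \in I -> (forall s, s \in I -> (p <= s)%N) ->
  first_elts I k.+1 = p |: first_elts (I :\ p) k.
Proof.
move=> Ip minp; apply/setP => t; rewrite !inE; case: (eqVneq t p) => [->|nt] /=.
  rewrite Ip (_ : set_rank I p = 0%N) //; apply: eq_card0 => u; rewrite !inE.
  by case: (boolP (u \in I)) => // /minp; rewrite leqNgt => /negPf.
case: (boolP (t \in I)) => //= It; rewrite (set_rankD1 t Ip).
have -> : (p < t)%N by rewrite ltn_neqAle eq_sym val_eqE nt minp.
by rewrite add1n ltnS.
Qed.

End FirstElements.

(** * Exactness for a matrix of pure powers *)

Section MonomialMatrix.

Variables (k : fieldType) (N : nat).
Local Notation n := N.+1.
Variables (A E om s : 'I_n -> nat).

Definition top_mnm (t : 'I_n) : 'X_{1..n} := (U_(t) *+ A t)%MM.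
Definition bot_mnm (t : 'I_n) : 'X_{1..n} := (U_(ordS t) *+ E t)%MM.

Definition monomial_mat : 'M[{mpoly k[n]}]_(2, n) :=
  \matrix_(r, t) 'X_[if r == 0 then top_mnm t else bot_mnm t].

Local Notation F := top_mnm.
Local Notation G := bot_mnm.
Local Notation M := monomial_mat.

Hypothesis slope : forall i j : 'I_n, (i < j)%N ->
  (wdeg om (G i) + wdeg om (F j) < wdeg om (F i) + wdeg om (G j))%N.
Hypothesis s_gt0 : forall i, (0 < s i)%N.
Hypothesis balanced : forall i j : 'I_n,
  (wdeg s (G i) + wdeg s (F j) = wdeg s (F i) + wdeg s (G j))%N.

Implicit Types (I J : {set 'I_n}) (m be : 'X_{1..n}) (p q t : 'I_n).

Lemma top_mnmE t i : F t i = ((t == i) * A t)%N.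
Proof. by rewrite mulmnE mnm1E. Qed.

Lemma bot_mnmE t i : G t i = ((ordS t == i) * E t)%N.
Proof. by rewrite mulmnE mnm1E. Qed.

Definition set_mnm I J : 'X_{1..n} :=
  (\sum_(t in I) (if t \in J then G t else F t))%MM.

Lemma set_mnmD1 I J t : t \in I ->
  set_mnm I J = ((if t \in J then G t else F t) + set_mnm (I :\ t) J)%MM.
Proof. by move=> It; rewrite /set_mnm (big_setD1 t). Qed.

Lemma set_mnmU1 I J t : t \notin I -> set_mnm I (t |: J) = set_mnm I J.
Proof.
move=> It; apply: eq_bigr => u Iu; rewrite !inE.
by case: eqP => // e; rewrite -e Iu in It.
Qed.

Lemma set_mnm_ge I J t : t \in I -> ((if t \in J then G t else F t) <= set_mnm I J)%MM.
Proof. by move=> It; rewrite (set_mnmD1 _ It) lem_addr. Qed.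

Definition slope_at (w : 'I_n -> nat) t : int := (wdeg w (G t))%:Z - (wdeg w (F t))%:Z.

Lemma slope_at_lt p q : (p < q)%N -> slope_at om p + 1 <= slope_at om q.
Proof. by move=> /slope; rewrite /slope_at; lia. Qed.

Lemma wdeg_set_mnm w I J : J \subset I -> (wdeg w (set_mnm I J))%:Z =
  \sum_(t in I) (wdeg w (F t))%:Z + \sum_(t in J) slope_at w t.
Proof.
move=> /setIidPr <-; rewrite wdeg_sum (big_morph Posz PoszD (erefl _)) /=.
rewrite [X in _ + X](eq_bigl (fun t => (t \in I) && (t \in J))); last first.
  by move=> t; rewrite inE.
rewrite big_mkcondr -big_split /=; apply: eq_bigr => t It; rewrite inE It /=.
by case: ifP => _; rewrite ?addr0 // /slope_at addrC subrK.
Qed.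

(** Exchange argument: off their intersection [P] and [J] have equally many columns, and each column
    of [P :\: J] precedes each of [J :\: P]. Slopes for [om] increase with the column. *)
Lemma wdeg_first_elts_lt I J d : J \subset I -> #|J| = d ->
    J != first_elts I d ->
  (wdeg om (set_mnm I (first_elts I d)) < wdeg om (set_mnm I J))%N.
Proof.
move=> sJI cardJ neJ; pose P := first_elts I d.
have cardP : #|P| = d by rewrite card_first_elts // -cardJ subset_leq_card.
have cardD : #|P :\: J| = #|J :\: P|.
  by apply/eqP; rewrite -(eqn_add2l #|P :&: J|) cardsID setIC cardsID cardP cardJ.
have /card_gt0P[q0 Jq0] : (0 < #|J :\: P|)%N.
  rewrite card_gt0 setD_eq0; apply: contra neJ => sJP.
  by rewrite eqEcard sJP cardP cardJ leqnn.
have /card_gt0P[p0 Pp0] : (0 < #|P :\: J|)%N.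
  by rewrite cardD; apply/card_gt0P; exists q0.
case: (@arg_maxnP _ p0 (mem (P :\: J)) val Pp0) => p /= Pp maxp.
rewrite -ltz_nat !wdeg_set_mnm ?first_elts_sub // ltrD2l -/P.
rewrite (big_setID J) [X in _ < X](big_setID P) /= setIC ltrD2l.
apply: (@le_lt_trans _ _ (slope_at om p *+ #|P :\: J|)).
  rewrite -sumr_const; apply: ler_sum => t Pt; have := maxp _ Pt.
  by rewrite leq_eqVlt => /orP[/eqP/val_inj->|/slope_at_lt] //; lia.
apply: (@lt_le_trans _ _ ((slope_at om p + 1) *+ #|J :\: P|)).
  by rewrite cardD ltr_pMn2r ?ltrDl //; apply/card_gt0P; exists q0.
rewrite -sumr_const; apply: ler_sum => t /setDP[Jt Pt].
by apply/slope_at_lt/(first_elts_lt _ (subsetP sJI _ Jt) Pt); case/setDP: Pp.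
Qed.

Lemma slope_at_const p q : slope_at s p = slope_at s q.
Proof. by rewrite /slope_at; have := balanced p q; lia. Qed.

Lemma wdeg_set_mnm_card I J J' : J \subset I -> J' \subset I -> #|J| = #|J'| ->
  wdeg s (set_mnm I J) = wdeg s (set_mnm I J').
Proof.
move=> sJ sJ' eqJ; apply/eqP; rewrite -eqz_nat !wdeg_set_mnm //.
suff sumE (U : {set 'I_n}) : \sum_(t in U) slope_at s t = slope_at s ord0 *+ #|U| by rewrite !sumE eqJ.
by rewrite -sumr_const; apply: eq_bigr => t _; apply: slope_at_const.
Qed.

(** The last column is left out because [p] has to be the first of a pair [p < q]. *)
Definition low be p : bool := (p.+1 < n)%N && (G p <= be)%MM.

Definition low0 be : 'I_n :=
  odflt ord0 [pick p | low be p && [forall q, low be q ==> (p <= q)%N]].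

Lemma low0P be q : low be q -> low be (low0 be) /\ (low0 be <= q)%N.
Proof.
move=> lq; rewrite /low0; case: pickP => [p /andP[lp /forallP minp]|] /=.
  by split=> //; apply: (implyP (minp q)).
case: (arg_minnP val lq) => p lp minp /(_ p) /negP[]; rewrite lp /=.
by apply/forallP => t; apply/implyP/minp.
Qed.

Definition high be q : bool := (low0 be < q)%N && (G (low0 be) + F q <= be)%MM.

Definition high0 be : 'I_n :=
  odflt ord0 [pick q | high be q && [forall t, high be t ==> (t <= q)%N]].

Lemma high0P be t : high be t -> high be (high0 be) /\ (t <= high0 be)%N.
Proof.
move=> ht; rewrite /high0; case: pickP => [q /andP[hq /forallP maxq]|] /=.
  by split=> //; apply: (implyP (maxq t)).
case: (arg_maxnP val ht) => q hq maxq /(_ q) /negP[]; rewrite hq /=.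
by apply/forallP => u; apply/implyP/maxq.
Qed.

Section SetTerm.

Variables (I : {set 'I_n}) (j : nat) (m : 'X_{1..n}).
Hypothesis ltjI : (j.+1 < #|I|)%N.

Local Notation P := (first_elts I j.+1).
Local Notation be := (m + set_mnm I P)%MM.
Local Notation p0 := (low0 be).
Local Notation q0 := (high0 be).

(** The least column [p] of [I] belongs to [P], so [G p] divides the multidegree; it is not the last
    column, as [I] has a second element. *)
Lemma low0_le : low be p0 /\ forall t, t \in I -> (p0 <= t)%N.
Proof.
have /card_gt0P[t0 It0] : (0 < #|I|)%N by apply: leq_trans ltjI.
have [p Ip minp] := set_minP It0.
have lp : low be p; last first.
  have [l0 le_p0p] := low0P lp; split=> // t /minp; apply: (leq_trans le_p0p).
have /card_gt0P[t /setD1P[tp It]] : (0 < #|I :\ p|)%N.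
  by rewrite -(ltn_add2l (p \in I)) -cardsD1 Ip; apply: leq_trans ltjI.
apply/andP; split.
  apply: leq_ltn_trans (ltn_ord t); rewrite ltn_neqAle minp //.
  by rewrite eq_sym val_eqE tp.
apply: lepm_trans (lem_addl m _); have := set_mnm_ge P Ip.
by rewrite (first_eltsS _ Ip minp) setU11.
Qed.

Lemma first_elts_low0 : p0 \in I -> P = p0 |: first_elts (I :\ p0) j.
Proof. by move=> Ip; apply: first_eltsS => //; case: low0_le. Qed.

(** This allows [p0] to be added to [I]. The variable of [G p0] could occur in [set_mnm I P] only as
    [F t] with [t = p0 + 1] outside [P]; but then an element of [P] precedes [t], and being at least
    [p0] it equals [p0], which is not in [I]. *)
Lemma low0_dvd : p0 \notin I -> (G p0 <= m)%MM.
Proof.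
have [/andP[]] := low0_le; move: p0 => p lt_p Gp minp Ip.
move: Gp; rewrite !lepm_pow mnmDE /set_mnm mnm_sumE big1 ?addn0 // => t It.
have nt : t != p by apply: contraNneq Ip => <-.
case: ifP => [_|/negbT Pt].
  by rewrite bot_mnmE (inj_eq (can_inj (@ordSK _))) (negPf nt).
rewrite top_mnmE; case: eqP => // e.
have /card_gt0P[q Pq] : (0 < #|P|)%N by rewrite card_first_elts // ltnW.
have := first_elts_lt Pq It Pt; rewrite e /= modn_small // ltnS.
have Iq := subsetP (first_elts_sub _ _) _ Pq.
rewrite leq_eqVlt ltnNge minp // orbF => /eqP/val_inj e'.
by rewrite -e' Iq in Ip.
Qed.

Lemma first_elts_low01 : p0 \in I -> j = 0%N -> P = [set p0].
Proof.
move=> Ip0 j0; apply: (etrans (first_elts_low0 Ip0)).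
by rewrite [in first_elts _ j]j0 first_elts0 setU0.
Qed.

Lemma high0_ge : p0 \in I -> j = 0%N ->
  high be q0 /\ forall t, t \in I -> t != p0 -> (t <= q0)%N.
Proof.
move=> Ip0 j0; have hi t : t \in I -> t != p0 -> high be t.
  rewrite /high; have [_] := low0_le; have := first_elts_low01 Ip0 j0.
  move: (p0) Ip0 => p Ip PE minp It tp; apply/andP; split.
    by rewrite ltn_neqAle eq_sym val_eqE tp minp.
  apply: lepm_trans (lem_addl m _); rewrite (set_mnmD1 _ Ip) PE set11.
  have It' : t \in I :\ p by rewrite !inE tp.
  have := set_mnm_ge [set p] It'; rewrite inE (negPf tp) => /mnm_lepP leF.
  by apply/mnm_lepP => i; rewrite !mnmDE leq_add2l.
have /card_gt0P[t /setD1P[tp It]] : (0 < #|I :\ p0|)%N.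
  by rewrite -(ltn_add2l (p0 \in I)) -cardsD1 Ip0; apply: leq_trans ltjI.
split=> [|u Iu up]; first by case: (high0P (hi _ It tp)).
by case: (high0P (hi _ Iu up)).
Qed.

(** This allows [q0] to be added to [I]. The variable of [F q0] could occur in [set_mnm I P] only
    through [G p0] with [p0 + 1 = q0]; then a second element of [I], after [p0] and at most [q0],
    would be [q0] itself. *)
Lemma high0_dvd : p0 \in I -> j = 0%N -> q0 \notin I -> (F q0 <= m)%MM.
Proof.
move=> Ip0 j0; have PE := first_elts_low01 Ip0 j0; have [/andP[]] := high0_ge Ip0 j0; have [/andP[lt_p _] minp] := low0_le.
have /card_gt0P[u /setD1P[up Iu]] : (0 < #|I :\ p0|)%N.
  by rewrite -(ltn_add2l (p0 \in I)) -cardsD1 Ip0; apply: leq_trans ltjI.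
move: (q0) (p0) PE Ip0 lt_p minp up => q p -> Ip lt_p minp up lt_pq GF maxq Iq.
have : (F q <= m + set_mnm I [set p])%MM by apply: lepm_trans GF; apply: lem_addl.
rewrite !lepm_pow mnmDE /set_mnm mnm_sumE big1 ?addn0 // => t It.
rewrite inE; case: eqP => [->|_]; last first.
  by rewrite top_mnmE; case: eqP => // e; rewrite -e It in Iq.
rewrite bot_mnmE; case: eqP => // e.
have lt_pu : (p < u)%N by rewrite ltn_neqAle eq_sym val_eqE up minp.
have := maxq _ Iu up; rewrite -e /= modn_small // => le_up.
have e' : u = q.
  by apply: val_inj; rewrite -e /= modn_small //; apply/eqP; rewrite eqn_leq le_up.
by rewrite -e' Iu in Iq.
Qed.

End SetTerm.

(** * The matching of terms of equal multidegree *)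

Local Notation term i := ('X_{1..n} * EN_basis n i)%type.
Local Notation EN i := (@EN_diff_coef _ n M i).

Definition term_set i (z : term i.+1) : {set 'I_n} := val z.2.1.
Definition term_idx i (z : term i.+1) : nat := z.2.2.
Definition term_deg i (z : term i.+1) : 'X_{1..n} :=
  (z.1 + set_mnm (term_set z) (first_elts (term_set z) (term_idx z).+1))%MM.

Lemma card_term_set i (z : term i.+1) : #|term_set z| = i.+2.
Proof. exact: eqP (valP z.2.1). Qed.

Lemma term_idx_lt i (z : term i.+1) : ((term_idx z).+1 < #|term_set z|)%N.
Proof. by rewrite card_term_set !ltnS -ltnS ltn_ord. Qed.

Lemma term_ext i (z z' : term i.+1) : z.1 = z'.1 -> term_set z = term_set z' ->
  term_idx z = term_idx z' -> z = z'.
Proof.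
case: z z' => [m [I j]] [m' [I' j']]; rewrite /term_set /term_idx /=.
by move=> -> /val_inj-> /val_inj->.
Qed.

Lemma term_coef_row i (z : term i.+2) (t : term i.+1) p :
    p \in term_set z -> term_set t = term_set z :\ p ->
  term_coef (EN i.+1) z t = (-1) ^+ set_rank (term_set z) p *
    (((z.1 + F p)%MM == t.1)%:R * (term_idx t == term_idx z)%:R
     + ((z.1 + G p)%MM == t.1)%:R * ((term_idx t).+1 == term_idx z)%:R).
Proof.
move=> Ip def_t; rewrite /term_coef (EN_coef_row _ Ip def_t) /contraction_coef.
rewrite mulrCA -[(-1) ^+ _ in LHS]signr_odd mulr_sign -signr_odd mulr_sign.
suff E1 : ('X_[z.1] * (M 0 p * (t.2.2 == z.2.2 :> nat)%:R
    + M 1 p * (t.2.2.+1 == z.2.2 :> nat)%:R))@_t.1 =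
    ((z.1 + F p)%MM == t.1)%:R * (term_idx t == term_idx z)%:R
     + ((z.1 + G p)%MM == t.1)%:R * ((term_idx t).+1 == term_idx z)%:R.
  by case: ifP => _; rewrite ?mcoeffN E1.
rewrite !mxE /= mulrDr !mulrA -!mpolyXD mcoeffD.
by rewrite !mulr_natr !mcoeffMn !mcoeffX.
Qed.

Lemma term_coef_neq0 i (z : term i.+2) (t : term i.+1) :
    term_coef (EN i.+1) z t != 0 ->
  exists p, [/\ p \in term_set z, term_set t = term_set z :\ p &
    term_idx t = term_idx z /\ t.1 = (z.1 + F p)%MM \/
    (term_idx t).+1 = term_idx z /\ t.1 = (z.1 + G p)%MM].
Proof.
move=> nz; have [p Ip def_t] : exists2 p, p \in term_set z & term_set t = term_set z :\ p.
  by apply: (@EN_coef_neq0 _ _ M); apply: contraNneq nz => e; rewrite /term_coef e mulr0 mcoeff0.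
exists p; split=> //.
have [/andP[/eqP e1 /eqP e2]|n1] :=
  boolP (((z.1 + F p)%MM == t.1) && (term_idx t == term_idx z)); first by left.
have [/andP[/eqP e1 /eqP e2]|n2] :=
  boolP (((z.1 + G p)%MM == t.1) && ((term_idx t).+1 == term_idx z)); first by right.
move: nz; rewrite (term_coef_row Ip def_t) -!natrM !mulnb (negPf n1) (negPf n2).
by rewrite addr0 mulr0 eqxx.
Qed.

Lemma term_coef_neq0_top i (z : term i.+2) (t : term i.+1) p :
    p \in term_set z -> term_set t = term_set z :\ p ->
    term_idx t = term_idx z -> t.1 = (z.1 + F p)%MM ->
  term_coef (EN i.+1) z t != 0.
Proof.
move=> Ip def_t eqi eqm; rewrite (term_coef_row Ip def_t) eqi eqm !eqxx.
by rewrite (gtn_eqF (ltnSn _)) mulr0 addr0 mulr1 mulr1 signr_eq0.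
Qed.

Lemma term_coef_neq0_bot i (z : term i.+2) (t : term i.+1) p :
    p \in term_set z -> term_set t = term_set z :\ p ->
    (term_idx t).+1 = term_idx z -> t.1 = (z.1 + G p)%MM ->
  term_coef (EN i.+1) z t != 0.
Proof.
move=> Ip def_t eqi eqm; rewrite (term_coef_row Ip def_t) -eqi eqm !eqxx.
by rewrite (ltn_eqF (ltnSn _)) mulr0 add0r mulr1 mulr1 signr_eq0.
Qed.

Local Notation termP z := (first_elts (term_set z) (term_idx z).+1).

Lemma low0_min i (z : term i.+1) p : p \in term_set z -> (low0 (term_deg z) <= p)%N.
Proof. by case: (low0_le z.1 (term_idx_lt z)) => _ /(_ p). Qed.

Lemma term_first_low0 i (z : term i.+1) :
  low0 (term_deg z) \in term_set z ->
  termP z = low0 (term_deg z) |: first_elts (term_set z :\ low0 (term_deg z)) (term_idx z).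
Proof. exact: first_elts_low0 (term_idx_lt z). Qed.

Lemma low0_lt_high0 i (z : term i.+1) :
  low0 (term_deg z) \in term_set z -> term_idx z = 0%N ->
  (low0 (term_deg z) < high0 (term_deg z))%N.
Proof. by move=> lz z0; case: (high0_ge (term_idx_lt z) lz z0) => /andP[]. Qed.

(** Passing to a boundary term replaces the initial segment [termP z] in the multidegree by a set
    [J] of the same size. Equal size preserves the [s]-degree, and [wdeg_first_elts_lt] raises [om]
    unless the two sets agree. *)
Lemma term_coef_cases i (z : term i.+2) (t : term i.+1) :
    term_coef (EN i.+1) z t != 0 ->
  exists p, [/\ p \in term_set z, term_set t = term_set z :\ p,
      wdeg s (term_deg t) = wdeg s (term_deg z) &
      (wdeg om (term_deg z) < wdeg om (term_deg t))%N \/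
      term_deg t = term_deg z /\
      ([/\ p \notin termP z, term_idx t = term_idx z & t.1 = (z.1 + F p)%MM] \/
       [/\ p \in termP z, (term_idx t).+1 = term_idx z & t.1 = (z.1 + G p)%MM])].
Proof.
move=> nz; have [p [Ip def_t tP]] := term_coef_neq0 nz.
have sub_t : termP t \subset term_set z :\ p by rewrite -def_t first_elts_sub.
have pt : p \notin termP t by apply/negP => /(subsetP sub_t); rewrite !inE eqxx.
have cardt : #|termP t| = (term_idx t).+1.
  by rewrite card_first_elts // ltnW ?term_idx_lt.
have [J [sJ cJ deg_t altJ]] : exists J, [/\ J \subset term_set z,
    #|J| = (term_idx z).+1, term_deg t = (z.1 + set_mnm (term_set z) J)%MM &
    [/\ p \notin J, term_idx t = term_idx z & t.1 = (z.1 + F p)%MM] \/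
    [/\ p \in J, (term_idx t).+1 = term_idx z & t.1 = (z.1 + G p)%MM]].
  case: tP => -[eqi eqm].
    exists (termP t); split; first exact: subset_trans sub_t (subsetDl _ _).
    - by rewrite cardt eqi.
    - by rewrite /term_deg eqm (set_mnmD1 _ Ip) (negPf pt) addmA def_t.
    by left.
  exists (p |: termP t); split.
  - by rewrite subUset sub1set Ip (subset_trans sub_t) ?subsetDl.
  - by rewrite cardsU1 pt cardt -eqi.
  - by rewrite /term_deg eqm (set_mnmD1 _ Ip) setU11 set_mnmU1 ?addmA ?def_t // !inE eqxx.
  by right; rewrite setU11.
exists p; split=> //.
  rewrite deg_t /term_deg !wdegD; congr (_ + _)%N; apply: wdeg_set_mnm_card => //.
    exact: first_elts_sub.
  by rewrite cJ card_first_elts // ltnW ?term_idx_lt.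
have [eJ|neJ] := eqVneq J (termP z); [right | left].
  by rewrite deg_t /term_deg -eJ.
by rewrite deg_t /term_deg !wdegD ltn_add2l wdeg_first_elts_lt.
Qed.

(* The terms that are matched with a term of the next homological degree. *)
Definition term_up i (z : term i.+1) : bool :=
  (low0 (term_deg z) \notin term_set z) ||
  (term_idx z == 0%N) && (high0 (term_deg z) \notin term_set z).

(** A tie-break within one multidegree: the boundary term that has lost the column prescribed by
    [term_down] gets the least value. *)
Definition term_tau i (z : term i.+1) : nat :=
  if low0 (term_deg z) \in term_set z then (high0 (term_deg z) \in term_set z).+1 else 0%N.

(** The factor 3 exceeds every [term_tau], so the order is lexicographic with [om] first. *)
Definition term_mu i (z : term i.+1) : nat :=
  (3 * wdeg om (term_deg z) + term_tau z)%N.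

Lemma term_tau_le i (z : term i.+1) : (term_tau z <= 2)%N.
Proof. by rewrite /term_tau; case: ifP => // _; case: (_ \in _). Qed.

(** The partner one homological degree lower. At index 0 the bottom entries contribute nothing to
    the contraction, so a column can leave only through its top entry. *)
Definition term_down i (z : term i.+2) (t : term i.+1) : Prop :=
  if term_idx z is j.+1 then
    [/\ term_set t = term_set z :\ low0 (term_deg z), term_idx t = j
      & t.1 = (z.1 + G (low0 (term_deg z)))%MM]
  else
    [/\ term_set t = term_set z :\ high0 (term_deg z), term_idx t = 0%N
      & t.1 = (z.1 + F (high0 (term_deg z)))%MM].

Lemma term_down_deg i (z : term i.+2) (t : term i.+1) :
  ~~ term_up z -> term_down z t -> term_deg t = term_deg z.
Proof.
rewrite /term_up negb_or negbK => /andP[lz hz] dzt.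
have Ez : term_deg z = (z.1 + set_mnm (term_set z) (termP z))%MM by [].
rewrite {1}/term_deg Ez (term_first_low0 lz).
have minl := @low0_min _ z; have := @low0_lt_high0 _ z lz; move: dzt hz.
rewrite /term_down; move: (low0 _) (high0 _) lz minl => l h lz minl.
case: (term_idx z) => [|j].
  move=> [-> -> ->]; rewrite eqxx negbK first_elts0 setU0 => hz /(_ erefl) lh.
  have hl : h != l by rewrite -val_eqE /= gtn_eqF.
  rewrite (@first_eltsS _ _ l); last by move=> p /setD1P[_ /minl].
    by rewrite first_elts0 setU0 (set_mnmD1 _ hz) inE (negPf hl) addmA.
  by rewrite !inE eq_sym hl.
move=> [-> -> ->] _ _.
by rewrite (set_mnmD1 _ lz) setU11 set_mnmU1 ?addmA // !inE eqxx.
Qed.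

(** Any other boundary term has larger [om], or the same multidegree; in the second case it keeps
    the column that [t] lost, so its [term_tau] is larger. *)
Lemma term_down_lead i (z : term i.+2) (t : term i.+1) :
  ~~ term_up z -> term_down z t -> lead_term (EN i.+1) (@term_mu i) z t.
Proof.
move=> upz dzt; have deg_t := term_down_deg upz dzt.
move: upz; rewrite /term_up negb_or negbK => /andP[lz].
have := @low0_lt_high0 _ z lz; have := term_first_low0 lz; move: dzt.
rewrite /term_down; case def_i: (term_idx z) => [|j].
  rewrite eqxx negbK /= first_elts0 setU0 => -[It it mt] Pz /(_ erefl) lh hz.
  have hl : high0 (term_deg z) != low0 (term_deg z) by rewrite -val_eqE /= gtn_eqF.
  split=> [|t' /term_coef_cases[p [Ip It' _]]].
    by apply: term_coef_neq0_top hz _ _ _; rewrite // it def_i.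
  case=> [lt|[deg_t' [[Pp it' mt']|[_]]]]; last by rewrite def_i.
    by right; rewrite /term_mu deg_t; have := term_tau_le t; lia.
  have [e|ph] := eqVneq p (high0 (term_deg z)).
    by left; apply: term_ext; rewrite ?mt' ?It' ?it' ?e ?def_i.
  have pl : p != low0 (term_deg z).
    by apply: contraNneq Pp => ->; rewrite def_i Pz set11.
  right; rewrite /term_mu deg_t deg_t' ltn_add2l /term_tau deg_t deg_t' It It'.
  rewrite !inE eqxx lz hz [low0 _ == high0 _]eq_sym hl.
by rewrite [low0 _ == p]eq_sym [high0 _ == p]eq_sym pl ph.
move=> [It it mt] Pz _ _; split=> [|t' /term_coef_cases[p [Ip It' _]]].
  by apply: term_coef_neq0_bot lz _ _ _; rewrite // it def_i.
case=> [lt|[deg_t' altp]].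
  by right; rewrite /term_mu deg_t; have := term_tau_le t; lia.
have [e|pl] := eqVneq p (low0 (term_deg z)).
  case: altp => -[]; rewrite def_i Pz e ?setU11 // => _ [it'] mt'.
  by left; apply: term_ext; rewrite ?mt' ?It' ?it' ?e.
right; rewrite /term_mu deg_t deg_t' ltn_add2l /term_tau deg_t deg_t' It It'.
by rewrite !inE eqxx lz [low0 _ == p]eq_sym pl.
Qed.

Definition mk_term i m I j (cI : #|I| == i.+2) (ltj : (j < i.+1)%N) : term i.+1 :=
  (m, (exist (fun J : {set 'I_n} => #|J| == i.+2) I cI, Ordinal ltj)).

Lemma term_down_ex i (z : term i.+2) : ~~ term_up z -> exists t : term i.+1, term_down z t.
Proof.
rewrite /term_up negb_or negbK /term_down => /andP[lz].
have sub_card p : p \in term_set z -> #|term_set z :\ p| == i.+2.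
  by move=> Ip; rewrite -eqSS -(card_term_set z) (cardsD1 p (term_set z)) Ip.
have := ltn_ord z.2.2; rewrite -/(term_idx z).
case: (term_idx z) => [|j] ltj; last first.
  by exists (mk_term (z.1 + G (low0 (term_deg z)))%MM (sub_card _ lz) (ltj : (j < i.+1)%N)).
rewrite eqxx negbK => hz.
by exists (mk_term (z.1 + F (high0 (term_deg z)))%MM (sub_card _ hz) (ltn0Sn i)).
Qed.

(** Both terms share the multidegree of [t], hence [low0] and [high0], and adding back the removed
    column recovers them. Were just one index 0, [t] would both contain and lack [low0]. *)
Lemma term_down_inj i (z1 z2 : term i.+2) (t : term i.+1) :
  ~~ term_up z1 -> ~~ term_up z2 -> term_down z1 t -> term_down z2 t -> z1 = z2.
Proof.
move=> up1 up2 d1 d2.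
have e : term_deg z1 = term_deg z2.
  by rewrite -(term_down_deg up1 d1) (term_down_deg up2 d2).
move: up1 up2 d1 d2; rewrite /term_up !negb_or !negbK /term_down e.
have lh1 := @low0_lt_high0 _ z1; have lh2 := @low0_lt_high0 _ z2; rewrite e in lh1 lh2.
move=> /andP[lz1 hz1] /andP[lz2 hz2].
move: hz1 hz2 lh1 lh2; case i1: (term_idx z1) => [|j1]; case i2: (term_idx z2) => [|j2].
- rewrite eqxx !negbK => hz1 hz2 _ _ [I1 _ m1] [I2 _ m2]; apply: term_ext; last by rewrite i1.
    by apply: (@addIm _ (F (high0 (term_deg z2)))); rewrite -m1.
  by rewrite -(setD1K hz1) -I1 I2 setD1K.
- rewrite eqxx negbK => hz1 _ /(_ lz1 erefl) lh _ [I1 _ _] [I2 _ _].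
  have: low0 (term_deg z2) \in term_set t by rewrite I1 !inE lz1 -val_eqE /= ltn_eqF.
  by rewrite I2 !inE eqxx.
- rewrite eqxx negbK => _ hz2 _ /(_ lz2 erefl) lh [I1 _ _] [I2 _ _].
  have: low0 (term_deg z2) \in term_set t by rewrite I2 !inE lz2 -val_eqE /= ltn_eqF.
  by rewrite I1 !inE eqxx.
move=> _ _ _ _ [I1 it1 m1] [I2 it2 m2]; apply: term_ext; last by rewrite i1 i2 -it1 -it2.
  by apply: (@addIm _ (G (low0 (term_deg z2)))); rewrite -m1.
by rewrite -(setD1K lz1) -I1 I2 setD1K.
Qed.

(** The matching is inverted by adding [low0] if it is missing and [high0] otherwise, and dividing
    the monomial by the corresponding entry. *)
Lemma term_down_surj i (t : term i.+1) : term_up t ->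
  exists2 z : term i.+2, ~~ term_up z & term_down z t.
Proof.
have lt_t := term_idx_lt t.
case: (boolP (low0 (term_deg t) \in term_set t)) => [lt|nlt] up_t; last first.
  pose l := low0 (term_deg t).
  have cI : #|l |: term_set t| == i.+3 by rewrite cardsU1 nlt card_term_set.
  have ltj : ((term_idx t).+1 < i.+2)%N by rewrite ltnS ltn_ord.
  pose z : term i.+2 := mk_term (t.1 - G l)%MM cI ltj.
  have tDl : (l |: term_set t) :\ l = term_set t by rewrite setU1K.
  have deg_z : term_deg z = term_deg t.
    rewrite /term_deg /term_set /term_idx /=.
    rewrite (@first_eltsS _ _ l) ?setU11 //; last first.
      by move=> p /setU1P[->|] //; apply: low0_min.
    rewrite tDl (@set_mnmD1 (l |: _) _ l) ?setU11 // set_mnmU1 ?tDl //.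
    by rewrite addmA submK //; apply: low0_dvd nlt; apply: term_idx_lt.
  exists z; first by rewrite /term_up deg_z /= setU11.
  by rewrite /term_down deg_z /= tDl submK //; apply: low0_dvd nlt; apply: term_idx_lt.
have /andP[/eqP t0 nht] : (term_idx t == 0%N) && (high0 (term_deg t) \notin term_set t).
  by move: up_t; rewrite /term_up lt.
pose h := high0 (term_deg t); have lh : (low0 (term_deg t) < h)%N := low0_lt_high0 lt t0.
have cI : #|h |: term_set t| == i.+3 by rewrite cardsU1 nht card_term_set.
pose z : term i.+2 := mk_term (t.1 - F h)%MM cI (ltn0Sn i.+1).
have tDh : (h |: term_set t) :\ h = term_set t by rewrite setU1K.
have Fh : (F h <= t.1)%MM := high0_dvd (term_idx_lt t) lt t0 nht.
have hl : h != low0 (term_deg t) by rewrite -val_eqE /= gtn_eqF.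
have deg_z : term_deg z = term_deg t.
  rewrite {1}/term_deg /term_set /term_idx /=.
  rewrite (@first_eltsS _ _ (low0 (term_deg t))); first last.
  - by move=> p /setU1P[->|]; [apply: ltnW | apply: low0_min].
  - by rewrite !inE lt orbT.
  rewrite first_elts0 setU0 (@set_mnmD1 (h |: _) _ h) ?setU11 // tDh inE (negPf hl).
  rewrite addmA submK // [RHS]/term_deg; congr (_ + set_mnm _ _)%MM.
  by rewrite term_first_low0 // t0 first_elts0 setU0.
exists z; first by rewrite /term_up deg_z /= !inE eqxx lt orbT.
by rewrite /term_down deg_z /= tDh submK.
Qed.

(** * Exactness in positive homological degrees *)

Definition base_mu (w : term 0) : nat := wdeg om w.1.

Lemma term_idx1 (z : term 1) : term_idx z = 0%N.
Proof. by apply/eqP; rewrite -leqn0 -ltnS; apply: ltn_ord z.2.2. Qed.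

(** For the columns [p < q] of [z], the minor has the terms [F p G q] and [F q G p]. By [slope] the
    second is the lighter one, and it yields the multidegree of [z]. *)
Lemma base_lead (z : term 1) : lead_term (EN 0) base_mu z (term_deg z, tt).
Proof.
have z0 := term_idx1 z.
have [p [q [pq def_I]]] := cards2_lt (card_term_set z).
have npq : p \notin [set q] by rewrite inE -val_eqE /= ltn_eqF.
have Pz : termP z = [set p].
  rewrite z0 (@first_eltsS _ _ p) ?first_elts0 ?setU0 // def_I ?set21 //.
  by move=> t /set2P[]->; rewrite // ltnW.
have deg_z : term_deg z = (z.1 + (F q + G p))%MM.
  rewrite /term_deg Pz def_I /set_mnm big_setU1 //= big_set1 set11 inE.
  by rewrite -val_eqE /= gtn_eqF // [(F q + _)%MM]addmC.
have lt_deg : (wdeg om (term_deg z) < wdeg om (z.1 + (F p + G q))%MM)%N.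
  by rewrite deg_z !wdegD; have := slope pq; lia.
have coef w : term_coef (EN 0) z w =
    ((z.1 + (F p + G q))%MM == w.1)%:R - (term_deg z == w.1)%:R.
  rewrite /term_coef /EN_diff_coef /= -/(term_set z) def_I wedge2_pair //.
  by rewrite /minor2 !mxE /= -!mpolyXD mulrBr -!mpolyXD mcoeffB !mcoeffX deg_z.
have ne : ((z.1 + (F p + G q))%MM == term_deg z) = false.
  by apply: contraTF lt_deg => /eqP->; rewrite ltnn.
split=> [|[m []]]; rewrite coef /=; first by rewrite ne eqxx sub0r oppr_eq0 oner_eq0.
case: (eqVneq (term_deg z) m) => [->|_]; first by left.
by case: (eqVneq (z.1 + _)%MM m) => [<-|_]; [right | rewrite subrr eqxx].
Qed.

(** A term of homological degree 1 that is not [up] has exactly the columns [low0] and [high0],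
    which depend on the multidegree alone. *)
Lemma base_lead_inj (z1 z2 : term 1) : ~~ term_up z1 -> ~~ term_up z2 ->
  term_deg z1 = term_deg z2 -> z1 = z2.
Proof.
have def_I (z : term 1) : ~~ term_up z ->
    term_set z = [set low0 (term_deg z); high0 (term_deg z)].
  rewrite /term_up negb_or negbK term_idx1 eqxx negbK => /andP[lz hz].
  apply/esym/eqP; rewrite eqEcard subUset !sub1set lz hz card_term_set cards2.
  by rewrite neq_ltn low0_lt_high0 ?term_idx1.
move=> up1 up2 e; have eI : term_set z1 = term_set z2 by rewrite !def_I // e.
apply: term_ext; rewrite ?term_idx1 //.
by move: e; rewrite /term_deg eI !term_idx1 => /addIm.
Qed.

Lemma EN_cycle_boundary i (v : {ffun EN_basis n i.+1 -> {mpoly k[n]}}) :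
  free_map (EN i) v = 0 -> exists u, v = free_map (EN i.+1) u.
Proof.
have lead_up (t : term i.+1) : term_up t ->
  exists2 z : term i.+2, lead_term (EN i.+1) (@term_mu i) z t &
    forall t' : term i.+1, term_coef (EN i.+1) z t' != 0 ->
      wdeg s (term_deg t') = wdeg s (term_deg t).
  move=> /term_down_surj[z upz dz]; exists z; first exact: term_down_lead.
  by move=> t' /term_coef_cases[p [_ _ -> _]]; rewrite (term_down_deg upz dz).
have mu_bounded w : exists K, forall t : term i.+1,
    (wdeg s (term_deg t) <= w)%N -> (term_mu t < K)%N.
  exists (3 * ((\sum_t om t) * w) + 3)%N => t le_w; rewrite /term_mu.
  have := wdeg_bound om s_gt0 (term_deg t); have := term_tau_le t.
  have := leq_mul (leqnn (\sum_t om t)%N) le_w; lia.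
case: i v lead_up mu_bounded => [|i] v lead_up mu_bounded.
  apply: (@cycle_boundary _ _ _ _ _ _ _ base_mu _ _ (@term_up 0)) lead_up mu_bounded v.
  - exact: free_map_comp (EN_comp_first M).
  - by move=> z _; exists (term_deg z, tt); apply: base_lead.
  move=> z1 z2 t up1 up2 lead1 lead2; apply: base_lead_inj => //.
  have e1 := lead_term_uniq (base_lead z1) lead1.
  have e2 := lead_term_uniq (base_lead z2) lead2.
  by rewrite -[LHS]/((term_deg z1, tt).1) e1 -e2.
apply: (@cycle_boundary _ _ _ _ _ _ _ (@term_mu i) _ _ (@term_up i.+1)) lead_up mu_bounded v.
- exact: free_map_comp (@EN_comp_higher _ _ M i).
- move=> z upz; have [t dzt] := term_down_ex upz.
  by exists t; apply: term_down_lead.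
move=> z1 z2 t up1 up2 lead1 lead2.
have [t1 d1] := term_down_ex up1; have [t2 d2] := term_down_ex up2.
have e1 := lead_term_uniq (term_down_lead up1 d1) lead1.
have e2 := lead_term_uniq (term_down_lead up2 d2) lead2.
by rewrite e1 in d1; rewrite e2 in d2; apply: term_down_inj d1 d2.
Qed.

(** * Standard monomials and the defining ideal *)

Definition standard be : Prop :=
  forall i j : 'I_n, (i < j)%N -> ~~ (G i + F j <= be)%MM.

Lemma standard_reduction al : exists nu,
  [/\ standard nu, wdeg s nu = wdeg s al & I2 M ('X_[al] - 'X_[nu])].
Proof.
pose K := ((\sum_t om t) * wdeg s al)%N.
suff H r : forall be, (K - wdeg om be < r)%N -> wdeg s be = wdeg s al ->
    exists nu, [/\ standard nu, wdeg s nu = wdeg s al & I2 M ('X_[be] - 'X_[nu])].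
  exact: H (ltnSn _) (erefl _).
elim: r => // r IH be lt_r deg_be.
case: (pickP (fun ij : 'I_n * 'I_n => (ij.1 < ij.2)%N && (G ij.1 + F ij.2 <= be)%MM)).
  move=> [i j] /= /andP[ltij le_be].
  pose be' := (be - (G i + F j) + (F i + G j))%MM.
  have def_be := submK le_be.
  have deg_be' : wdeg s be' = wdeg s al.
    by rewrite -deg_be -[in RHS]def_be !wdegD; have := balanced i j; lia.
  have om_be' : (wdeg om be < wdeg om be')%N.
    by rewrite -[in X in (X < _)%N]def_be !wdegD; have := slope ltij; lia.
  have le_K : (wdeg om be' <= K)%N by rewrite /K -deg_be'; apply: wdeg_bound.
  have [|nu [std_nu deg_nu I_nu]] := IH be' _ deg_be'; first by lia.
  exists nu; split=> //; rewrite -(subrK 'X_[be'] 'X_[be]) -addrA.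
  apply: ideal_genD I_nu; rewrite -[X in 'X_[X] - _]def_be /be' !mpolyXD -mulrBr.
  apply: ideal_genMl; rewrite -opprB; apply: ideal_genN; apply: mem_ideal_gen.
  by exists 0, 1, i, j; rewrite /minor2 !mxE /= [X in _ - X]mulrC.
move=> none; exists be; split=> // [i j ltij|]; last by rewrite subrr; apply: ideal_gen0.
by have := none (i, j); rewrite /= ltij => /= ->.
Qed.

Hypothesis standard_inj : forall al be,
  standard al -> standard be -> wdeg s al = wdeg s be -> al = be.

Lemma eq_wdeg_I2 al be : wdeg s al = wdeg s be -> I2 M ('X_[al] - 'X_[be]).
Proof.
move=> e; have [nu [std deg I]] := standard_reduction al.
have [nu' [std' deg' I']] := standard_reduction be.
rewrite (standard_inj std std' _) in I; last by rewrite deg e deg'.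
by have := ideal_genB I I'; rewrite opprB addrA subrK.
Qed.

Lemma toricX m : toric s ('X_[m] : {mpoly k[n]}) = 'X^(wdeg s m).
Proof.
rewrite /toric mmapX /mmap1 /wdeg -prodrXr; apply: eq_bigr => i _.
by rewrite -exprM mulnC.
Qed.

Lemma toricE (f : {mpoly k[n]}) :
  toric s f = \sum_(m <- msupp f) f@_m *: 'X^(wdeg s m).
Proof.
rewrite {1}[f]mpolyE /toric raddf_sum; apply: eq_bigr => m _ /=.
by rewrite mmapZ -mul_polyC -[mmap _ _ _]/(toric s 'X_[m]) toricX.
Qed.

(** One monomial is chosen for each degree. The search below [e.+1] suffices because positive
    weights give [mdeg m <= wdeg s m]; the default 0 concerns only degrees that no monomial has. *)
Definition mnm_of_wdeg e : 'X_{1..n} :=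
  if [pick m : 'X_{1..n < e.+1} | wdeg s m == e] is Some m then val m else 0%MM.

Lemma mnm_of_wdegP m : wdeg s (mnm_of_wdeg (wdeg s m)) = wdeg s m.
Proof.
rewrite /mnm_of_wdeg; case: pickP => [m' /eqP|none] //.
have lt_m : (mdeg m < (wdeg s m).+1)%N.
  rewrite ltnS mdegE; apply: leq_sum => i _.
  by rewrite leq_pmulr.
by have := none (BMultinom lt_m); rewrite eqxx.
Qed.

Lemma defining_idealE (f : {mpoly k[n]}) : defining_ideal s f <-> I2 M f.
Proof.
split=> [f0|]; last first.
  apply: I2_least => [|g h|r j1 j2 _].
  - exact: raddf0.
  - by rewrite /defining_ideal /toric mmapD => -> ->; rewrite addr0.
  rewrite /defining_ideal /toric rmorphM /= -[mmap _ _ (minor2 _ _ _ _ _)]/(toric _ _).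
  suff -> : toric s (minor2 M 0 1 j1 j2) = 0 by rewrite mulr0.
  rewrite /minor2 !mxE /= -!mpolyXD /toric mmapB -!/(toric _ _) !toricX !wdegD.
  by rewrite addnC [X in _ - 'X^X]addnC balanced addnC subrr.
rewrite [f]mpolyE.
(* Collected by degree, the chosen representatives have the coefficients of [toric s f], which
   vanish. So subtracting them leaves [f] unchanged, and each difference lies in [I2 M]. *)
have -> : \sum_(m <- msupp f) f@_m *: 'X_[m] =
    \sum_(m <- msupp f) f@_m *: ('X_[m] - 'X_[mnm_of_wdeg (wdeg s m)]).
  under [RHS]eq_bigr => m _ do rewrite scalerBr.
  rewrite sumrB; suff -> : \sum_(m <- msupp f) f@_m *: 'X_[mnm_of_wdeg (wdeg s m)] = 0
    :> {mpoly k[n]} by rewrite subr0.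
  pose B := (\max_(m <- msupp f) wdeg s m).+1.
  transitivity (\sum_(e < B) (toric s f)`_e *: 'X_[mnm_of_wdeg e] : {mpoly k[n]}).
    rewrite toricE; under [RHS]eq_bigr => e _ do rewrite coef_sum scaler_suml.
    rewrite exchange_big /=; apply: eq_big_seq => m fm.
    have lt_m : (wdeg s m < B)%N by rewrite ltnS; apply: leq_bigmax_seq.
    rewrite (bigD1 (Ordinal lt_m)) //= coefZ coefXn eqxx mulr1 big1 ?addr0 // => e.
    by rewrite -val_eqE /= coefZ coefXn => /negPf->; rewrite mulr0 scale0r.
  by rewrite f0; apply: big1 => e _; rewrite coef0 scale0r.
apply: ideal_gen_sum => m _; rewrite -mul_mpolyC; apply: ideal_genMl.
by apply: eq_wdeg_I2; rewrite mnm_of_wdegP.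
Qed.

Lemma mcoeff_mulX_notle (p : {mpoly k[n]}) m al : ~~ (m <= al)%MM -> (p * 'X_[m])@_al = 0.
Proof.
move=> nle; apply/eqP; rewrite mcoeff_eq0; apply: contra nle => al_p.
have /mapP[m' _ ->] : al \in [seq (m + m')%MM | m' <- msupp p].
  by rewrite -(perm_mem (msuppMX p m)).
exact: lem_addr.
Qed.

(** Both terms of a minor contain a top entry, so a monomial divisible by no [F t] occurs in no
    multiple of a minor. *)
Lemma I2_mcoeff_top al f : (forall t, ~~ (F t <= al)%MM) -> I2 M f -> f@_al = 0.
Proof.
move=> nF; apply: (@I2_least _ _ _ (fun g => g@_al = 0)) => [|g h|r j1 j2 _].
- exact: mcoeff0.
- by rewrite mcoeffD => -> ->; rewrite addr0.
rewrite /minor2 !mxE /= -!mpolyXD mulrBr mcoeffB !mcoeff_mulX_notle ?subrr //.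
  by apply: contra (nF j2) => /(lepm_trans _)->; rewrite ?lem_addr.
by apply: contra (nF j1) => /(lepm_trans _)->; rewrite ?lem_addr.
Qed.

Lemma I2_mcoeff_bot al f : (forall t, ~~ (G t <= al)%MM) -> I2 M f -> f@_al = 0.
Proof.
move=> nG; apply: (@I2_least _ _ _ (fun g => g@_al = 0)) => [|g h|r j1 j2 _].
- exact: mcoeff0.
- by rewrite mcoeffD => -> ->; rewrite addr0.
rewrite /minor2 !mxE /= -!mpolyXD mulrBr mcoeffB !mcoeff_mulX_notle ?subrr //.
  by apply: contra (nG j1) => /(lepm_trans _)->; rewrite ?lem_addl.
by apply: contra (nG j2) => /(lepm_trans _)->; rewrite ?lem_addl.
Qed.

Lemma ideal_I2_image (f : {mpoly k[n]}) :
  I2 M f <-> exists u, f = free_map (EN 0) u tt.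
Proof.
split=> [|[u ->]]; last first.
  rewrite ffunE; apply: ideal_gen_sum => x _; apply: ideal_genMl.
  have [p [q [pq def_x]]] := cards2_lt (eqP (valP x.1)).
  rewrite /EN_diff_coef def_x wedge2_pair //; apply: mem_ideal_gen.
  by exists 0, 1, p, q.
apply: (@I2_least _ _ _ (fun g => exists u, g = free_map (EN 0) u tt)).
- by exists 0; rewrite free_map0 ffunE.
- by move=> _ _ [u ->] [v ->]; exists (u + v); rewrite free_mapD [RHS]ffunE.
move=> r p q pq.
have cI : #|[set p; q]| == 2%N by rewrite cards2 neq_ltn pq.
pose x : EN_basis n 1 := (mk_term 0%MM cI (ltn0Sn 0)).2.
exists [ffun y => if y == x then r else 0]; rewrite ffunE (bigD1 x) //= big1.
  by rewrite ffunE eqxx addr0 /EN_diff_coef wedge2_pair.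
by move=> y /negPf yx; rewrite ffunE yx mul0r.
Qed.

(** In positive degrees this is the [s]-degree of the multidegree of the basis vector: its initial
    segment has [x.2 + 1] columns, each adding the common slope. *)
Definition EN_deg i : EN_basis n i -> int :=
  match i with
  | 0 => fun=> 0
  | i'.+1 => fun x =>
      \sum_(t in val x.1) (wdeg s (F t))%:Z + slope_at s ord0 * x.2.+1%:Z
  end.

Lemma wdeg_bot t : (wdeg s (G t))%:Z = (wdeg s (F t))%:Z + slope_at s ord0.
Proof. by rewrite (slope_at_const ord0 t) /slope_at addrC subrK. Qed.

Lemma EN_coef_homog i (x : EN_basis n i.+1) (y : EN_basis n i) :
  whomog s (EN_deg x - EN_deg y) (EN_diff_coef M x y).
Proof.
move=> m; case: i x y => [|i] x y.
  have [p [q [pq def_x]]] := cards2_lt (eqP (valP x.1)).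
  have x0 : (x.2 : nat) = 0%N by apply/eqP; rewrite -leqn0 -ltnS; apply: ltn_ord.
  have npq : p \notin [set q] by rewrite inE -val_eqE /= ltn_eqF.
  rewrite /EN_diff_coef /EN_deg def_x wedge2_pair // /minor2 !mxE /= -!mpolyXD x0.
  rewrite subr0 mulr1 big_setU1 //= big_set1 => /msuppB_le.
  by rewrite mem_cat !msuppX !inE => /orP[]/eqP->; rewrite wdegD PoszD wdeg_bot; ring.
rewrite mcoeff_msupp => nz.
have [|p [Ip def_y alt]] := @term_coef_neq0 i (0%MM, x) (m, y).
  by rewrite /term_coef mpolyX0 mul1r.
rewrite /term_set /= in Ip def_y; rewrite /EN_deg (big_setD1 p) //= -def_y.
move: alt; rewrite /term_idx /= !add0m => -[[-> ->]|[<- ->]].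
  by ring.
by rewrite wdeg_bot (intS y.2.+1); ring.
Qed.

Hypothesis A_gt0 : forall t, (0 < A t)%N.
Hypothesis E_gt0 : forall t, (0 < E t)%N.

Lemma mpolyX_irrelevant i e : (0 < e)%N ->
  @irrelevant_ideal k n 'X_[U_(i) *+ e].
Proof.
case: e => // e _; rewrite mulmS mpolyXD mulrC.
by apply/ideal_genMl/mem_ideal_gen; exists i.
Qed.

Lemma mat_irrelevant r t : irrelevant_ideal (M r t).
Proof. by rewrite mxE; case: ifP => _; apply: mpolyX_irrelevant. Qed.

Lemma EN_coef_irrelevant i (x : EN_basis n i.+1) (y : EN_basis n i) :
  irrelevant_ideal (EN_diff_coef M x y).
Proof.
case: i x y => [|i] x y.
  do 2![apply: ideal_gen_sum => ? _]; apply: ideal_genB; apply: ideal_genMl;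
  exact: mat_irrelevant.
rewrite EN_coefE; apply: ideal_gen_sum => t _; apply: ideal_genMl.
by apply: ideal_genD; rewrite mulrC; apply: ideal_genMl; apply: mat_irrelevant.
Qed.

Lemma EN_resolution :
  @graded_minimal_free_resolution k n s (Eagon_Northcott M) EN_deg (fun=> 1).
Proof.
have augE (v : {ffun unit -> {mpoly k[n]}}) :
    augmentation s (fun=> 1) v = toric s (v tt).
  by rewrite /augmentation (bigD1 tt) //= big1 ?addr0 ?mulr1.
split.
- exact: EN_coef_homog.
- by move=> x j; rewrite coef1; case: j => [|j] //=; rewrite eqxx.
- move=> p; split=> [[f ->]|[v ->]]; last by exists (v tt); apply: augE.
  by exists [ffun=> f]; rewrite [RHS]augE ffunE.
- move=> v; rewrite [augmentation _ _ _]augE.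
  apply: iff_trans (defining_idealE _) _; apply: iff_trans (ideal_I2_image _) _.
  by split=> -[u def_v]; exists u; [apply/ffunP => -[] | rewrite def_v].
- move=> i v; split=> [|[u ->]]; first exact: EN_cycle_boundary.
  case: i u {v} => [|i] u; first exact: (free_map_comp (EN_comp_first M)).
  exact: (free_map_comp (@EN_comp_higher _ _ M i)).
move=> i u y; rewrite ffunE; apply: ideal_gen_sum => x _; apply: ideal_genMl.
exact: EN_coef_irrelevant.
Qed.

End MonomialMatrix.

(** * The semigroup *)

Section Repunit.

Variables (a N c d e : nat).
Local Notation n := N.+1.
Variable s : 'I_n -> nat.
Local Notation R := (repunit a).
Let m := (c * R N + 1)%N.

Hypotheses (a_ge2 : (2 <= a)%N) (N_ge2 : (2 <= N)%N) (c_gt0 : (1 <= c)%N).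
Hypothesis e_gt0 : (1 <= e)%N.

Definition top_exp (t : 'I_n) : nat := if t.+1 == n then c else a.
Definition bot_exp (t : 'I_n) : nat := if t.+1 == n then e else 1%N.
(* The weight of the first variable is so large that the last column, whose
   second entry is a power of it, has the greatest slope. *)
Definition rep_order (t : 'I_n) : nat :=
  if t == 0%N :> nat then ((c + 1) * (a + 1) ^ n)%N else ((a + 1) ^ t)%N.

Local Notation A := top_exp.
Local Notation E := bot_exp.
Local Notation om := rep_order.
Local Notation F := (top_mnm A).
Local Notation G := (bot_mnm E).

Implicit Types (t p q : 'I_n) (al be : 'X_{1..n}).

Lemma repunit0 : R 0 = 0%N.
Proof. by rewrite /repunit expn0 div0n. Qed.

Lemma top_exp_gt0 t : (0 < A t)%N.
Proof. by rewrite /top_exp; case: ifP => _; lia. Qed.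

Lemma bot_exp_gt0 t : (0 < E t)%N.
Proof. by rewrite /bot_exp; case: ifP. Qed.

Lemma ordS_val t : t != ord_max -> ordS t = t.+1 :> nat.
Proof.
move=> nt /=; rewrite modn_small // ltn_neqAle ltn_ord andbT.
by apply: contra nt => /eqP[e']; apply/eqP/val_inj.
Qed.

Lemma ordS_last : ordS (ord_max : 'I_n) = ord0.
Proof. by apply: val_inj; rewrite /= modnn. Qed.

Lemma exp_last : (A ord_max = c) * (E ord_max = e).
Proof. by rewrite /top_exp /bot_exp /= eqxx. Qed.

Lemma exp_not_last t : t != ord_max -> (A t = a) * (E t = 1%N).
Proof.
move=> nt; rewrite /top_exp /bot_exp eqSS.
have /negPf-> : (t : nat) != N by apply: contra nt => /eqP e'; apply/eqP/val_inj.
by [].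
Qed.

Lemma lt_not_last t q : (t < q)%N -> t != ord_max.
Proof. by apply: contraTneq => ->; rewrite -leqNgt /= -ltnS. Qed.

Lemma ordS_pred t : (0 < t)%N -> exists2 p, ordS p = t & (p < t)%N.
Proof.
move=> t_gt0; have p_val : (inord t.-1 : 'I_n) = t.-1 :> nat.
  by rewrite inordK // (leq_trans _ (ltn_ord t)) // ltnS leq_pred.
have pt : ((inord t.-1 : 'I_n) < t)%N by rewrite p_val prednK.
exists (inord t.-1) => //; apply: ord_inj.
by rewrite (ordS_val (lt_not_last pt)) p_val prednK.
Qed.

Lemma wdeg_top w t : wdeg w (F t) = (A t * w t)%N.
Proof. by rewrite wdegMn wdegU. Qed.

Lemma wdeg_bottom w t : wdeg w (G t) = (E t * w (ordS t))%N.
Proof. by rewrite wdegMn wdegU. Qed.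

(** Away from the first and last columns the slope is [(a+1)^(t+1) - a (a+1)^t = (a+1)^t]. The large
    weight of the variable 0 lowers the slope of the first column and raises that of the last. *)
Lemma rep_slope p q : (p < q)%N ->
  (wdeg om (G p) + wdeg om (F q) < wdeg om (F p) + wdeg om (G q))%N.
Proof.
move=> pq; have np := lt_not_last pq.
rewrite !wdeg_bottom !wdeg_top !(exp_not_last np).
have -> : om (ordS p) = ((a + 1) * (a + 1) ^ p)%N.
  by rewrite /rep_order ordS_val //= expnS.
have -> : om q = ((a + 1) ^ q)%N.
  by rewrite /rep_order; case: eqP => // q0; rewrite q0 in pq.
have le_p : ((a + 1) ^ p <= om p)%N.
  rewrite /rep_order; case: eqP => // ->; rewrite expn0.
  by rewrite muln_gt0 expn_gt0; lia.
have lt_pq : ((a + 1) ^ p < (a + 1) ^ q)%N by rewrite ltn_exp2l //; lia.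
have [q_last|nq] := eqVneq q ord_max.
  rewrite q_last ordS_last !exp_last {2}/rep_order /= in lt_pq *.
  rewrite expnS; nia.
rewrite !(exp_not_last nq).
have -> : om (ordS q) = ((a + 1) * (a + 1) ^ q)%N.
  by rewrite /rep_order ordS_val //= expnS.
nia.
Qed.

(** * Standard monomials as greedy expansions *)

Local Notation standard := (standard A E).

Lemma lepm_col al p q : (p < q)%N -> (G p + F q <= al)%MM =
  (0 < al (ordS p))%N && ((ordS p == q) + A q <= al q)%N.
Proof.
move=> pq; have np := lt_not_last pq.
apply/mnm_lepP/andP => [le_al|[le_p le_q] i].
  have := le_al (ordS p); have := le_al q.
  rewrite !mnmDE !bot_mnmE !top_mnmE !(exp_not_last np) !eqxx !muln1 !mul1n.
  by move=> -> /(leq_trans _)->.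
rewrite !mnmDE !bot_mnmE !top_mnmE !(exp_not_last np) muln1.
have [<-|_] := eqVneq q i; first by rewrite mul1n.
by case: eqP => // <-; rewrite addn0.
Qed.

Lemma standard_le al t : standard al -> (0 < t)%N -> (al t <= A t)%N.
Proof.
move=> std_al t_gt0; have [p Sp pt] := ordS_pred t_gt0.
have := std_al p t pt; rewrite lepm_col // Sp eqxx add1n negb_and -leqNgt -ltnNge.
by case/orP => //; rewrite leqn0 => /eqP->.
Qed.

Lemma standard_zero al q t : standard al -> (0 < t)%N -> (t < q)%N ->
  (A q <= al q)%N -> al t = 0%N.
Proof.
move=> std_al t_gt0 tq le_q; have [p Sp pt] := ordS_pred t_gt0.
have := std_al p q (ltn_trans pt tq); rewrite lepm_col ?(ltn_trans pt) // Sp.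
by rewrite -val_eqE /= ltn_eqF // add0n le_q andbT -leqNgt leqn0 => /eqP.
Qed.

(** These are the conditions of the greedy expansion in repunits: no digit exceeds [A], and below a
    digit that reaches [A] all digits vanish. The exponent of the variable 0 is free. *)
Lemma standardP al : (forall t, (0 < t)%N -> (al t <= A t)%N) ->
    (forall q t, (0 < t)%N -> (t < q)%N -> (A q <= al q)%N -> al t = 0%N) ->
  standard al.
Proof.
move=> le_al zero_al p q pq; rewrite lepm_col //; apply/negP => /andP[p0 le_q].
have Sp := ordS_val (lt_not_last pq).
have [e'|ne] := eqVneq (ordS p) q.
  by move: le_q; rewrite e' eqxx leqNgt add1n ltnS le_al // -e' Sp.
rewrite (zero_al q (ordS p)) ?Sp // in p0; last exact: leq_trans (leq_addl _ _) le_q.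
by rewrite ltn_neqAle pq andbT -Sp val_eqE.
Qed.

Definition digit al i : nat := al (inord i).
(** The exponent of the variable 0 does not count, because [R 0 = 0]. *)
Definition value al l : nat := (\sum_(i < l.+1) digit al i * R i)%N.

Lemma value0 al : value al 0 = 0%N.
Proof. by rewrite /value big_ord1 repunit0 muln0. Qed.

Lemma valueS al l : value al l.+1 = (value al l + digit al l.+1 * R l.+1)%N.
Proof. by rewrite /value big_ord_recr. Qed.

Lemma repunit_gt0 i : (0 < R i.+1)%N.
Proof. by rewrite repunitS //; lia. Qed.

Lemma value_vanish al l : (forall i, (0 < i <= l)%N -> digit al i = 0%N) ->
  value al l = 0%N.
Proof.
elim: l => [|l IH] z; first exact: value0.
by rewrite valueS z ?leqnn // IH // => i /andP[i0 il]; rewrite z // i0 ltnW.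
Qed.

Lemma digit_full al l : standard al -> (0 < l <= N)%N ->
    (A (inord l) <= digit al l)%N -> value al l.-1 = 0%N.
Proof.
case: l => // l std_al /= lN le_l; apply: value_vanish => i /andP[i0 il].
by apply: (standard_zero (q := inord l.+1)) le_l; rewrite ?inordK //; lia.
Qed.

(** Here [R (l+1) = a R l + 1] for [l > 0]: a top digit [a] forces the lower part to be 0, and a
    smaller digit leaves room for a lower part below [R l]. *)
Lemma value_lt al l : standard al -> (l < N)%N -> (value al l < R l.+1)%N.
Proof.
move=> std_al; elim: l => [|l IH] lN; first by rewrite value0 repunit_gt0.
have nl : (inord l.+1 : 'I_n) != ord_max by rewrite -val_eqE /= inordK //; lia.
rewrite valueS (@repunitS a l.+1) //.
have [le_l|lt_l] := leqP a (digit al l.+1).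
  have le_a : (digit al l.+1 <= a)%N.
    by rewrite -(exp_not_last nl).1 standard_le // inordK //; lia.
  rewrite (@digit_full al l.+1) ?(exp_not_last nl) //; last by lia.
  have := repunit_gt0 l; nia.
have := IH (ltnW lN); have := repunit_gt0 l; nia.
Qed.

Lemma value_top al : standard al -> (value al N < m)%N.
Proof.
move=> std_al; have N0 : (0 < N)%N by lia.
have iN : (inord N : 'I_n) = ord_max by apply: val_inj; rewrite /= inordK.
rewrite -(prednK N0) valueS prednK // /m addn1 ltnS.
have [le_l|lt_l] := leqP c (digit al N).
  have le_c : (digit al N <= c)%N.
    by rewrite -[X in (_ <= X)%N]exp_last.1 -iN standard_le // inordK.
  have -> : value al N.-1 = 0%N.
    by apply: digit_full => //; [lia | rewrite iN exp_last.1].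
  by rewrite add0n leq_mul2r le_c orbT.
have := @value_lt al N.-1 std_al; rewrite prednK // leqnn => /(_ isT).
nia.
Qed.

Lemma value_inj al be l : standard al -> standard be -> (l <= N)%N ->
  value al l = value be l -> forall i, (0 < i <= l)%N -> digit al i = digit be i.
Proof.
move=> sal sbe; elim: l => [|l IH] lN; first by move=> _ [].
have la := value_lt sal lN; have lb := value_lt sbe lN.
rewrite !valueS => eq_v.
have eq_d : digit al l.+1 = digit be l.+1.
  have := congr1 (divn^~ (R l.+1)) eq_v.
  by rewrite /= !divnDMl ?repunit_gt0 // !divn_small.
move=> i /andP[i0]; rewrite leq_eqVlt => /orP[/eqP->//|il].
by apply: IH; rewrite ?i0 ?(ltnW lN) //; move: eq_v; rewrite eq_d => /addIn.
Qed.

Hypothesis s_def : forall t, s t = (m + d * R t)%N.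

Lemma gen_gt0 t : (0 < s t)%N.
Proof. by rewrite s_def /m; lia. Qed.

Lemma wdeg_gen al : wdeg s al = (mdeg al * m + d * value al N)%N.
Proof.
rewrite /wdeg mdegE /value big_distrl big_distrr -big_split /=.
apply: eq_bigr => t _; rewrite s_def /digit inord_val; nia.
Qed.

Hypothesis co_md : coprime m d.

(** Modulo [m] the degree is [d] times the value. As [d] is prime to [m] and values are below [m],
    the degree determines the value, hence all digits; the total degree then fixes the exponent of
    the variable 0. *)
Lemma rep_standard_inj al be :
  standard al -> standard be -> wdeg s al = wdeg s be -> al = be.
Proof.
move=> sal sbe; rewrite !wdeg_gen => eq_w.
have eq_v : value al N = value be N.
  have: d * value al N = d * value be N %[mod m].
    by have := congr1 (modn^~ m) eq_w; rewrite /= !modnMDl.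
  wlog le_v : al be sal sbe {eq_w} / (value al N <= value be N)%N.
    move=> W /esym eq_v; case/orP: (leq_total (value al N) (value be N)) => le_v.
      by apply: W => //; apply/esym.
    by apply/esym/W.
  move/esym/eqP; rewrite eqn_mod_dvd ?leq_mul2l ?le_v ?orbT // -mulnBr Gauss_dvdr //.
  move=> /dvdnP[[|k] ek]; first by lia.
  have := value_top sbe; nia.
have eq_m : mdeg al = mdeg be.
  have m_gt0 : (0 < m)%N by rewrite /m addn1.
  by apply/eqP; rewrite -(eqn_pmul2r m_gt0) -(eqn_add2r (d * value al N)%N) {2}eq_v eq_w.
have eq_t t : (0 < t)%N -> al t = be t.
  move=> t0; have := value_inj sal sbe (leqnn N) eq_v (i := t).
  by rewrite /digit inord_val t0 -ltnS ltn_ord; apply.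
apply/mnmP => t; have [t0|/eqP t0] := posnP t; last by apply: eq_t; lia.
move: eq_m; rewrite !mdegE (bigD1 t) //= [RHS](bigD1 t) //=.
rewrite (eq_bigr (fun i => be i)) => [/addIn//|i nti]; apply: eq_t.
by rewrite lt0n; apply: contra nti => /eqP i0; apply/eqP/val_inj; rewrite /= i0 t0.
Qed.

Hypothesis e_def : (e + a = d + c + 1)%N.

(** The difference of the two degrees is [d - (a-1) m], the parameter [b] of the theorem; sums are
    used because it may be negative. For the last column the reason is [c R N = m - 1]. *)
Lemma gen_col t : (wdeg s (G t) + (a - 1) * m = wdeg s (F t) + d)%N.
Proof.
rewrite wdeg_bottom wdeg_top; have [->|nt] := eqVneq t ord_max.
  rewrite ordS_last !exp_last !s_def /= repunit0.
  have -> : (e = d + c + 1 - a)%N by lia.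
  rewrite /m; nia.
rewrite !(exp_not_last nt) !s_def ordS_val // repunitS //; nia.
Qed.

Lemma rep_balanced p q :
  (wdeg s (G p) + wdeg s (F q) = wdeg s (F p) + wdeg s (G q))%N.
Proof. by have := gen_col p; have := gen_col q; lia. Qed.

(** * The Apery set and the pseudo-Frobenius numbers *)

Local Notation H := (gen_semigroup s).

Lemma gen_semigroupE h : H h <-> exists al, h = wdeg s al.
Proof.
split=> [[x ->]|[al ->]].
  by exists [multinom x i | i < n]; apply: eq_bigr => i _; rewrite mnmE.
by exists [ffun i => al i]; apply: eq_bigr => i _; rewrite ffunE.
Qed.

Lemma rep_reduction al : exists nu, standard nu /\ wdeg s nu = wdeg s al.
Proof.
have [nu [std_nu deg_nu _]] :=
  @standard_reduction rat N A E om s rep_slope gen_gt0 rep_balanced al.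
by exists nu.
Qed.

Lemma wdeg0_gen : wdeg s U_(ord0) = m.
Proof. by rewrite wdegU s_def repunit0 muln0 addn0. Qed.

Lemma ordS_gt0 p : p != ord_max -> (0 < ordS p)%N.
Proof. by move/ordS_val->. Qed.

Lemma standard_U0 al : standard al -> standard (al + U_(ord0))%MM.
Proof.
have E0 t : (0 < t)%N -> (al + U_(ord0))%MM t = al t.
  by move=> t0; rewrite mnmDE mnm1E -val_eqE /= ltn_eqF // addn0.
move=> std_al; apply: standardP => [t t0|q t t0 tq].
  by rewrite E0 // standard_le.
by rewrite !E0 ?(leq_ltn_trans _ tq) //; apply: standard_zero tq.
Qed.

(** This puts the degree of [al] in the Apery set for [m]. For [h] in [H], a standard monomial of
    degree [h] times the variable 0 is standard of degree [h + m]; by uniqueness it would be [al],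
    which lacks that variable. *)
Lemma standard_not_shift al h : standard al -> al ord0 = 0%N -> H h ->
  wdeg s al <> (h + m)%N.
Proof.
move=> std_al al0 /gen_semigroupE[be ->] eq_w.
have [nu [std_nu deg_nu]] := rep_reduction be.
have e' : al = (nu + U_(ord0))%MM.
  by apply: rep_standard_inj std_al (standard_U0 std_nu) _; rewrite wdegD wdeg0_gen deg_nu.
by move: al0; rewrite e' mnmDE mnm1E eqxx addn1.
Qed.

Definition top_standard (j : nat) : 'X_{1..n} :=
  [multinom (if t == j :> nat then A t else if (j < t)%N then (A t).-1 else 0%N) | t < n].

Lemma top_standardE j t : top_standard j t =
  if t == j :> nat then A t else if (j < t)%N then (A t).-1 else 0%N.
Proof. exact: mnmE. Qed.

Lemma top_standard_std j : standard (top_standard j).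
Proof.
apply: standardP => [t t0|q t t0 tq]; rewrite !top_standardE.
  by case: ifP => // _; case: ifP => // _; apply: leq_pred.
have := top_exp_gt0 q; case: (ltngtP q j) => [qj|jq|qj]; last 2 first.
- by lia.
- by move=> _; rewrite -qj (ltn_eqF tq) (ltnNge q) (ltnW tq).
by lia.
Qed.

Lemma ord_ltF p q : (p < q)%N -> (p == q) = false.
Proof. by rewrite -val_eqE => /ltn_eqF. Qed.

Lemma top_standard_next p : p != ord_max ->
  (top_standard p + G p = top_standard p.+1 + F p)%MM.
Proof.
move=> np; apply/mnmP => t; have A0 := top_exp_gt0 t.
have Sp : (ordS p == t) = (p.+1 == t :> nat).
  by apply/eqP/eqP => [<-|e']; [rewrite ordS_val | apply: ord_inj; rewrite ordS_val].
have Ap : p = t :> nat -> A t = a by move=> /ord_inj <-; rewrite exp_not_last.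
rewrite !mnmDE !top_standardE bot_mnmE top_mnmE Sp -(val_eqE p) /= !(exp_not_last np).
move: (nat_of_ord t) (nat_of_ord p) (A t) A0 Ap => x y z z0 zE; rewrite muln1.
case: (ltngtP x y) => [lt|lt|eq_xy]; case: (ltngtP x y.+1) => //=; lia.
Qed.

(* The exchange [G p F q -> F p G q] moves the pair of columns [(p, q)] to
   [(p - 1, q + 1)] until it produces the variable of degree [m]. *)
Lemma shift_chain p q be : (p < q)%N -> (G p + F q <= be)%MM ->
    (forall t, (q < t)%N -> ((A t).-1 <= be t)%N) ->
  exists ga, wdeg s be = (wdeg s ga + m)%N.
Proof.
move def_r: (p : nat) => r.
elim: r => [|r IH] in p def_r q be * => pq le_be tail_be;
  rewrite -def_r in pq; pose be' := (be - (G p + F q) + (F p + G q))%MM.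
all: have deg_be : wdeg s be = wdeg s be'.
1,3: by rewrite -{1}(submK le_be) !wdegD; have := rep_balanced p q; lia.
all: have fin : (0 < be' ord0)%N -> exists ga, wdeg s be = (wdeg s ga + m)%N.
1,3: move=> be0; exists (be' - U_(ord0))%MM; rewrite deg_be -wdeg0_gen -wdegD submK //;
  by apply/mnm_lepP => i; rewrite mnm1E; case: eqP => [<-|].
(* The chain stops here when [p] is the first column, as [F p] is a power of the variable 0; it also
   stops when [q] is the last one, where [G q] is such a power. *)
- apply: fin; rewrite !mnmDE top_mnmE (_ : p = ord0); last exact: ord_inj.
  by rewrite eqxx mul1n; have := top_exp_gt0 ord0; lia.
have [q_last|nq] := eqVneq q ord_max.
  apply: fin; rewrite !mnmDE bot_mnmE q_last ordS_last eqxx mul1n.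
  by have := bot_exp_gt0 ord_max; lia.
pose p' : 'I_n := inord r.
have p'_val : p' = r :> nat by rewrite inordK // ltnW // -def_r.
have Sp' : ordS p' = p.
  by apply: ord_inj; rewrite ordS_val ?p'_val // -val_eqE /= p'_val; have := ltn_ord p; lia.
have Sq := ordS_val nq; have Sp := ordS_val (lt_not_last pq).
have be'E t : (q < t)%N -> be' t = (be t + (ordS q == t))%N.
  move=> qt; have pt := ltn_trans pq qt.
  rewrite !mnmDE mnmBE mnmDE !bot_mnmE !top_mnmE !(exp_not_last nq).
  by rewrite (ord_ltF pt) (ord_ltF qt) ord_ltF ?Sp ?(leq_ltn_trans pq) // subn0 muln1.
have qSq : (q < ordS q)%N by rewrite Sq.
have p'q' : (p' < ordS q)%N by rewrite Sq p'_val -ltnS -def_r (ltn_trans pq).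
have [|||ga ga_eq] := IH p' p'_val (ordS q) be'.
- by rewrite -p'_val.
(* [G q] raises the exponent of its variable from at least [A - 1] to at least [A], as [F (q + 1)]
   requires; [F p] supplies the variable [G (p - 1)]. *)
- rewrite lepm_col // Sp' (ord_ltF (ltn_trans pq qSq)) add0n (be'E (ordS q)) // eqxx addn1.
  have := tail_be _ qSq; rewrite -ltnS prednK ?top_exp_gt0 // => ->.
  rewrite andbT !mnmDE top_mnmE eqxx mul1n.
  by have := top_exp_gt0 p; lia.
- move=> t qt; rewrite be'E ?(ltn_trans qSq) //.
  exact: leq_trans (tail_be _ (ltn_trans qSq qt)) (leq_addr _ _).
by exists ga; rewrite deg_be.
Qed.

Lemma maximal_standard nu : standard nu -> nu ord0 = 0%N ->
    (forall t, (0 < t)%N -> ~ standard (nu + U_(t))%MM) ->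
  exists2 j, (0 < j <= N)%N & nu = top_standard j.
Proof.
move=> std_nu nu0 max_nu; case: (pickP (fun q => (0 < q)%N && (A q <= nu q)%N)).
  move=> q /andP[q0 le_q]; exists (q : nat); first by rewrite q0 -ltnS ltn_ord.
  apply/mnmP => t; rewrite top_standardE; case: (ltngtP t q) => [tq|qt|/ord_inj->].
  - have [t0|t0] := posnP t; last exact: standard_zero le_q.
    by rewrite -[RHS]nu0; congr (nu _); apply: ord_inj.
  - have t0 := ltn_trans q0 qt.
    have q_full (u : 'I_n) : (q < u)%N -> (nu u < A u)%N.
      move=> qu; rewrite ltnNge; apply/negP => /(standard_zero std_nu q0 qu) z.
      by move: le_q (top_exp_gt0 q); rewrite z; lia.
    apply/eqP; rewrite eqn_leq -ltnS prednK ?top_exp_gt0 // q_full //= leqNgt.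
    apply/negP => lt_t; apply: (max_nu t t0); apply: standardP => [u u0|v u u0 uv].
      rewrite mnmDE mnm1E; case: eqP => [<-|_]; first by lia.
      by rewrite addn0 standard_le.
    rewrite !mnmDE !mnm1E; case: eqP => [<-|_]; first by lia.
    rewrite addn0 => le_v; rewrite (standard_zero std_nu u0 uv le_v) add0n.
    case: eqP => // e'; rewrite -e' in uv; have := q_full v (ltn_trans qt uv).
    by rewrite ltnNge le_v.
  by apply/eqP; rewrite eqn_leq le_q standard_le.
move=> none; have lt_nu t : (0 < t)%N -> (nu t < A t)%N.
  by move=> t0; have := none t; rewrite t0 ltnNge => /= ->.
(* With no full exponent the variable 1 can still be multiplied in: even if its exponent becomes
   full, no positive index lies below it. *)
have i1 : (inord 1 : 'I_n) = 1%N :> nat by rewrite inordK //; lia.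
case: (max_nu (inord 1)); rewrite ?i1 //; apply: standardP => [t t0|q t t0 tq].
  by rewrite mnmDE mnm1E; have := lt_nu t t0; case: eqP => _; lia.
rewrite mnmDE mnm1E; case: eqP => [e'|_]; first by move: tq; rewrite -e' i1; lia.
by rewrite addn0 leqNgt lt_nu ?(ltn_trans t0).
Qed.

(** The extra variable creates a pair from which [shift_chain] starts: [(i - 1, j)] if [i <= j], and
    otherwise [(j - 1, i)], since the exponent of [i] rises from [A i - 1] to [A i]. *)
Lemma top_standard_shift j (i : 'I_n) : (0 < j <= N)%N -> (0 < i)%N ->
  exists ga, (wdeg s (top_standard j) + s i = wdeg s ga + m)%N.
Proof.
move=> /andP[j0 jN] i0; pose q : 'I_n := inord j.
have q_val : q = j :> nat by rewrite inordK.
rewrite -(wdegU s i) -wdegD; set be := (_ + _)%MM.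
have beE t : be t = (top_standard j t + (i == t))%N by rewrite mnmDE mnm1E.
case: (leqP i q) => [iq|qi].
  have [p Sp pi] := ordS_pred i0.
  apply: (shift_chain (leq_trans pi iq)) => [|t qt].
    rewrite lepm_col ?(leq_trans pi) // Sp !beE eqxx addn1 /=.
    by rewrite top_standardE q_val eqxx addnC.
  by rewrite beE top_standardE -q_val gtn_eqF // qt leq_addr.
have [p Sp pq] : exists2 p, ordS p = q & (p < q)%N by apply: ordS_pred; rewrite q_val.
apply: (shift_chain (ltn_trans pq qi)) => [|t it].
  rewrite lepm_col ?(ltn_trans pq) // Sp !beE !top_standardE q_val eqxx eqxx.
  rewrite -q_val qi (gtn_eqF qi) (ord_ltF qi).
  by have := top_exp_gt0 q; have := top_exp_gt0 i; lia.
by rewrite beE top_standardE -q_val (ltn_trans qi) // gtn_eqF ?leq_addr // (ltn_trans qi).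
Qed.

(** If [f] is pseudo-Frobenius, a standard monomial of degree [f + m] lacks the variable 0, because
    [f] is not in [H], and it is maximal, because [f + s t] is in [H]. Conversely
    [top_standard_shift] moves each generator past the Apery set. *)
Lemma PF_top_standard (f : int) : PF H f <->
  exists2 j, (0 < j <= N)%N & f + m%:Z = (wdeg s (top_standard j))%:Z.
Proof.
have Hm : H m by apply/gen_semigroupE; exists U_(ord0)%MM; rewrite wdeg0_gen.
have m_gt0 : (0 < m)%N by rewrite /m addn1.
split=> [[nHf fH]|[j j_bd def_f]].
  have [_ /gen_semigroupE[be ->]] := fH m m_gt0 Hm.
  have [nu [std_nu <-]] := rep_reduction be => def_f.
  have nu0 : nu ord0 = 0%N.
    apply/eqP; rewrite -leqn0 leqNgt; apply/negP => nu0; apply: nHf.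
    exists (wdeg s (nu - U_(ord0))%MM); first by apply/gen_semigroupE; eexists.
    have le0 : (U_(ord0) <= nu)%MM by rewrite -[U_(_)%MM]mulm1n lepm_pow.
    by move: def_f; rewrite -{1}(submK le0) wdegD wdeg0_gen PoszD => /addIr.
  have [|j j_bd nuE] := maximal_standard std_nu nu0; last by exists j; rewrite -?nuE.
  move=> t t0 std_t.
  have [|h Hh fE] := fH (s t) (gen_gt0 t).
    by apply/gen_semigroupE; exists U_(t)%MM; rewrite wdegU.
  apply: (standard_not_shift std_t _ Hh); first by rewrite mnmDE nu0 mnm1E -val_eqE /= gtn_eqF.
  by rewrite wdegD wdegU; lia.
have top0 : top_standard j ord0 = 0%N.
  by rewrite top_standardE; case: j j_bd {def_f}.
split=> [[h Hh fE]|h h_gt0 /gen_semigroupE[al def_h]].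
  by apply: (standard_not_shift (top_standard_std j) top0 Hh); lia.
have [t t_al] : exists t, (0 < al t)%N.
  apply/existsP; apply: contraTT h_gt0; rewrite negb_exists => /forallP al0.
  rewrite def_h -leqNgt /wdeg big1 // => t _.
  by have := al0 t; rewrite lt0n negbK => /eqP->.
have le_t : (U_(t) <= al)%MM by rewrite -[U_(_)%MM]mulm1n lepm_pow.
have [ga gaE] : exists ga, (wdeg s (top_standard j) + s t = wdeg s ga + m)%N.
  have [t0|t0] := posnP t; last exact: top_standard_shift.
  exists (top_standard j); congr addn; rewrite -wdeg0_gen wdegU; congr (s _).
  exact: ord_inj.
exists (wdeg s (ga + (al - U_(t)))%MM); first by apply/gen_semigroupE; eexists.
have : wdeg s al = (wdeg s (al - U_(t))%MM + s t)%N.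
  by rewrite -{1}(submK le_t) wdegD wdegU.
by rewrite wdegD; lia.
Qed.

(** The monomial of degree [h] when [b > 0]: no [F t] divides it, and its product with the variable
    0 is [top_standard 0]. *)
Definition base_mnm : 'X_{1..n} := [multinom (A t).-1 | t < n].

Lemma wdeg_top_standard j : (j <= N)%N ->
  (wdeg s (top_standard j) + j * ((a - 1) * m) = wdeg s base_mnm + m + j * d)%N.
Proof.
elim: j => [_|j IH jN].
  rewrite !mul0n !addn0 -wdeg0_gen -wdegD; congr (wdeg s _); apply/mnmP => t.
  rewrite top_standardE mnmDE mnm1E mnmE -(val_eqE _ t) /= eq_sym.
  by case: (ltngtP t 0%N) => //= _; rewrite ?addn0 // addn1 prednK // top_exp_gt0.
pose p : 'I_n := inord j.
have p_val : p = j :> nat by rewrite inordK // ltnS ltnW.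
have np : p != ord_max by rewrite -val_eqE /= p_val ltn_eqF.
have := congr1 (wdeg s) (top_standard_next np); rewrite !wdegD p_val.
by have := gen_col p; have := IH (ltnW jN); rewrite !mulSn; lia.
Qed.

Lemma wdeg_top_standard_last :
  (wdeg s (top_standard N) + d = e * m + (a - 1) * m)%N.
Proof.
have -> : top_standard N = F ord_max.
  apply/mnmP => t; rewrite top_standardE top_mnmE -(val_eqE _ t) /= [N == t]eq_sym.
  by case: eqP => [/(@ord_inj _ _ ord_max)->|_]; rewrite ?mul1n // ltnNge -ltnS ltn_ord.
by rewrite -gen_col wdeg_bottom ordS_last exp_last.2 s_def repunit0 muln0 addn0.
Qed.

(** A second factorization would give a binomial of the ideal with coefficient 1 at [al], but [al]
    occurs in no element of the ideal. *)
Lemma rep_unique_factorization al :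
    (forall t, ~~ (F t <= al)%MM) \/ (forall t, ~~ (G t <= al)%MM) ->
  unique_factorization s (wdeg s al).
Proof.
move=> no_col; exists [ffun i => al i]; split.
  by apply: eq_bigr => i _; rewrite ffunE.
move=> x def_al; pose be : 'X_{1..n} := [multinom x i | i < n].
have eq_w : wdeg s al = wdeg s be.
  by rewrite def_al; apply: eq_bigr => i _; rewrite mnmE.
have I_al := @eq_wdeg_I2 rat N A E om s rep_slope gen_gt0 rep_balanced
  rep_standard_inj _ _ eq_w.
have : ('X_[al] - 'X_[be] : {mpoly rat[n]})@_al = 0.
  by case: no_col => no; [apply: I2_mcoeff_top no I_al | apply: I2_mcoeff_bot no I_al].
rewrite mcoeffB !mcoeffX eqxx; have [e' _|_] := eqVneq be al.
  by apply/ffunP => i; rewrite ffunE -e' mnmE.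
by rewrite subr0 => /eqP; rewrite oner_eq0.
Qed.

Lemma rep_PF_unique : exists h alpha : nat,
  [/\ (0 < alpha)%N,
      forall f : int, PF H f <->
        exists2 j : nat, (1 <= j <= N)%N & f = (h + j * alpha)%:Z
    & unique_factorization s h].
Proof.
have m_ge2 : (2 <= m)%N.
  by have := repunit_gt0 N.-1; rewrite prednK ?/m; [nia | lia].
have e_ge1 := e_gt0.
(* Equality would make [m >= 2] a common divisor of [m] and [d]. *)
have ne : d != ((a - 1) * m)%N.
  apply: contraTneq co_md => ->; rewrite /coprime gcdnMl; lia.
have [lt_d|gt_d] : (((a - 1) * m < d) \/ (d < (a - 1) * m))%N by lia.
  exists (wdeg s base_mnm), (d - (a - 1) * m)%N; split; first by lia.
    move=> f; apply: iff_trans (PF_top_standard f) _; split=> -[j j_bd def_f]; exists j => //;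
    have jN : (j <= N)%N by [case/andP: j_bd]; have := wdeg_top_standard jN;
    have : (j * ((a - 1) * m) <= j * d)%N by [rewrite leq_mul2l (ltnW lt_d) orbT];
    move: def_f; rewrite mulnBr; lia.
  apply: rep_unique_factorization; left=> t; rewrite lepm_pow mnmE.
  by have := top_exp_gt0 t; lia.
(* For a negative difference [h = (e - 1) m]: the only [G t] in the variable 0 is its [e]-th power,
   so no [G t] divides this monomial. *)
pose al : 'X_{1..n} := (U_(ord0) *+ e.-1)%MM.
pose alpha := ((a - 1) * m - d)%N.
exists (wdeg s al), alpha; split; first by rewrite /alpha; lia.
  have topE j : (j <= N)%N ->
      (wdeg s (top_standard j) + j * alpha = wdeg s al + m + N.+1 * alpha)%N.
    have wal : (wdeg s al + m = e * m)%N.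
      by rewrite wdegMn wdeg0_gen -mulSnr prednK.
    have alphaE : ((a - 1) * m = d + alpha)%N by rewrite /alpha; lia.
    have := wdeg_top_standard (leqnn N); have := wdeg_top_standard_last.
    move=> last lastN jN; have := wdeg_top_standard jN; move: last lastN.
    by rewrite alphaE !mulnDr mulSn; lia.
  (* The degrees now decrease with [j], so the progression is read backwards through [N + 1 - j]. *)
  move=> f; apply: iff_trans (PF_top_standard f) _; split=> -[j /andP[j0 jN] def_f];
    exists (N.+1 - j)%N; try lia.
    have := topE j jN; rewrite mulnBl.
    by have : (j * alpha <= N.+1 * alpha)%N by [rewrite leq_mul2r leqW ?orbT]; lia.
  have := topE (N.+1 - j)%N _; rewrite mulnBl => /(_ ltac:(lia)).
  by have : (j * alpha <= N.+1 * alpha)%N by [rewrite leq_mul2r leqW ?orbT]; lia.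
apply: rep_unique_factorization; right=> t; rewrite lepm_pow mulmnE mnm1E.
have [->|nt] := eqVneq t ord_max; first by rewrite ordS_last eqxx exp_last.2; lia.
rewrite (exp_not_last nt).2; case: eqP => [e'|_]; last by rewrite mul0n.
by have := ordS_gt0 nt; rewrite -e'.
Qed.

End Repunit.

(** * The given family as an instance *)

Lemma mat_monomial (k : fieldType) (a N c : nat) (b : int) :
  mat k a N.+1 c b = monomial_mat k (@top_exp a N c) (@bot_exp N (corner_exp a N.+1 c b)).
Proof.
by apply/matrixP => r t; rewrite !mxE /=; case: (r == 0); rewrite mpolyXn.
Qed.

Theorem theorem1p3 (a n c : nat) (b : int)
    (ha : (2 <= a)%N) (hn : (3 <= n)%N) (hc : (1 <= c <= a)%N)
    (hb : - (a%:Z - 2) * (multiplicity a n c)%:Z - 2 <= b)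
    (hmb : gcdz (multiplicity a n c)%:Z b = 1) :
  let s : 'I_n -> nat := gens a c b in
  let H : nat -> Prop := gen_semigroup s in
  exists h alpha : nat,
    [/\ (0 < alpha)%N,
        forall f : int, PF H f <->
          exists2 j : nat, (1 <= j <= n.-1)%N & f = (h + j * alpha)%:Z,
        unique_factorization s h
      & forall k : fieldType,
          (forall f : {mpoly k[n]},
             defining_ideal s f <-> I2 (mat k a n c b) f) /\
          exists deg : forall i, free_basis (Eagon_Northcott (mat k a n c b)) i -> int,
            graded_minimal_free_resolution s deg (fun _ => 1)].
Proof.
have /andP[c_gt0 _] := hc.
case: n hn hb hmb => // N hn hb hmb s H.
have a_le_d := step_ge ha hn c_gt0 hb.
(* Since [step] is at least [a], the absolute value in [d] changes nothing. *)
pose d := `|step a N.+1 c b|%N; pose e := corner_exp a N.+1 c b.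
have dE : d%:Z = step a N.+1 c b by rewrite /d; lia.
have eE : e%:Z = step a N.+1 c b + c%:Z + 1 - a%:Z := corner_expE ha hn c_gt0 hb.
have s_def t : s t = (c * repunit a N + 1 + d * repunit a t)%N.
  have [_] := gens_pos t ha hn c_gt0 hb; rewrite -dE -/s /multiplicity /=; lia.
have e_def : (e + a = d + c + 1)%N by lia.
have e_gt0 : (1 <= e)%N by lia.
have co_md : coprime (c * repunit a N + 1) d.
  have : gcdz (multiplicity a N.+1 c)%:Z d%:Z = 1 by rewrite dE /step gcdzMDl.
  by rewrite /gcdz /= /coprime => -[->].
have [h [alpha [alpha_gt0 PF_h uniq_h]]] :=
  rep_PF_unique ha hn c_gt0 e_gt0 s_def co_md e_def.
exists h, alpha; split=> // k; rewrite mat_monomial -/e.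
have slope := rep_slope ha hn c_gt0 e_gt0.
have s_gt0 := gen_gt0 ha hn c_gt0 e_gt0 s_def.
have balanced := rep_balanced ha hn c_gt0 e_gt0 s_def co_md e_def.
have std_inj := rep_standard_inj ha hn c_gt0 e_gt0 s_def co_md.
split; first exact: (defining_idealE slope s_gt0 balanced std_inj).
exists (EN_deg (top_exp a c) (bot_exp e) s).
apply: EN_resolution slope s_gt0 balanced std_inj _ _.
  exact: top_exp_gt0 ha hn c_gt0 e_gt0.
exact: bot_exp_gt0 e_gt0.
Qed.
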